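(* There is a constant $C>0$, depending only on $d$, such that for every isotropic unimodal Lévy process $\mathbf{X}$ on $\mathbb{R}^d$ and all $t>0$, $x\in\mathbb{R}^d\setminus\{0\}$, \[ p(t,x)\le C\,t\,|x|^{-d}K_d(|x|). \]
   Context: An isotropic unimodal Lévy process on $\mathbb{R}^d$ is a pure-jump Lévy process $\mathbf{X}=(X_t)_{t\ge0}$, $X_0=0$, whose Lévy measure has a radial, radially non-increasing density $\nu$; for $t>0$ the law of $X_t$ on $\mathbb{R}^d\setminus\{0\}$ has a radial non-increasing density $p(t,x)$. For $r>0$, $K_d(r)=r^{-2}\int_{|y|\le r}|y|^2\nu(y)\,\mathrm{d}y$. *)

(* Defs.v *)
From HB Require Import structures.
From mathcomp Require Import all_boot all_order all_algebra.
From mathcomp Require Import all_classical all_reals all_analysis.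
Import Order.TTheory GRing.Theory Num.Theory numFieldNormedType.Exports.
Set Implicit Arguments. Unset Strict Implicit. Unset Printing Implicit Defensive.
Local Open Scope classical_set_scope.
Local Open Scope ring_scope.

(** Euclidean space R^d is modelled as [d.-tuple R], with the product
    (Borel) sigma-algebra provided by MathComp-Analysis for tuples. *)
Section Rd.
Variable R : realType.

Definition Rd (d : nat) := d.-tuple (measurableTypeR R).

Definition dotRd d (x y : Rd d) : R := \sum_(i < d) tnth x i * tnth y i.
Definition normRd d (x : Rd d) : R := Num.sqrt (\sum_(i < d) tnth x i ^+ 2).

Definition zeroRd d : Rd d := [tuple (0 : R) | _ < d].
Definition subRd d (x y : Rd d) : Rd d := [tuple tnth x i - tnth y i | i < d].

Definition consRd d (p : measurableTypeR R * Rd d) : Rd d.+1 :=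
  [tuple of p.1 :: (p.2 : seq _)].

Fixpoint lebRd (d : nat) : set (Rd d) -> \bar R :=
  match d return set (Rd d) -> \bar R with
  | 0 => fun A => (\1_A (zeroRd 0))%:E
  | d'.+1 => pushforward ((@lebesgue_measure R) \x (@lebRd d'))%E (@consRd d')
  end.

End Rd.

Definition radial_nonincreasing (R : realType) (d : nat) (f : Rd R d -> R) :=
  exists g : R -> R,
    (forall r s : R, 0 < r -> r <= s -> g s <= g r) /\
    (forall x : Rd R d, x != zeroRd R d -> f x = g (normRd x)).

Definition unimodal_levy_density (R : realType) (d : nat) (nu : Rd R d -> R) :=
  [/\ measurable_fun [set: Rd R d] nu,
      (forall y, 0 <= nu y),
      radial_nonincreasing nu &
      (\int[@lebRd R d]_y (Num.min 1 (normRd y ^+ 2) * nu y)%:E < +oo)%E].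

Definition levy_exponent (R : realType) (d : nat) (nu : Rd R d -> R) (xi : Rd R d)
  : R := fine (\int[@lebRd R d]_y ((1 - cos (dotRd xi y)) * nu y)%:E)%E.

Definition levy_process (R : realType) (d0 : measure_display)
  (T : measurableType d0) (P : probability T R) (d : nat)
  (X : R -> T -> Rd R d) :=
  [/\ (forall w, X 0 w = zeroRd R d),
      (forall t, 0 <= t -> measurable_fun [set: T] (X t)),
      (forall (n : nat) (s : nat -> R) (A : nat -> set (Rd R d)),
          0 <= s 0%N -> (forall k, s k <= s k.+1) -> (forall k, measurable (A k)) ->
          P (\bigcap_(k in [set k | (k < n)%N])
               [set w | A k (subRd (X (s k.+1) w) (X (s k) w))]) =
          (\prod_(k < n) P [set w | A k (subRd (X (s k.+1) w) (X (s k) w))])%E),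
      (forall (s t : R) (A : set (Rd R d)), 0 <= s -> s <= t -> measurable A ->
          P [set w | A (subRd (X t w) (X s w))] = P [set w | A (X (t - s) w)]) &
      (forall w (i : 'I_d) (t : R), 0 <= t ->
          (fun u => tnth (X u w) i : R) @ t^'+ --> (tnth (X t w) i : R) /\
          (0 < t -> cvg ((fun u => tnth (X u w) i : R) @ t^'-)))].

(** X is a pure-jump (no Gaussian part, no drift) Levy process whose Levy
    measure has density nu, i.e. (symmetric Levy-Khintchine formula for the
    triplet (0, 0, nu)):  E exp(i xi . X_1) = exp(-psi(xi)), written via its
    real and imaginary parts. *)
Definition pure_jump_levy_process (R : realType) (d0 : measure_display)
  (T : measurableType d0) (P : probability T R) (d : nat)
  (X : R -> T -> Rd R d) (nu : Rd R d -> R) :=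
  levy_process P X /\
  (forall xi : Rd R d,
      (\int[P]_w (cos (dotRd xi (X 1 w)))%:E = (expR (- levy_exponent nu xi))%:E /\
       \int[P]_w (sin (dotRd xi (X 1 w)))%:E = 0)%E).

Definition radial_density_of (R : realType) (d0 : measure_display)
  (T : measurableType d0) (P : probability T R) (d : nat)
  (X : R -> T -> Rd R d) (p : R -> Rd R d -> R) :=
  forall t, 0 < t ->
    [/\ measurable_fun [set: Rd R d] (p t),
        (forall x, 0 <= p t x),
        radial_nonincreasing (p t) &
        (forall A : set (Rd R d), measurable A ->
          P [set w | (A `\ zeroRd R d) (X t w)] =
          (\int[@lebRd R d]_(x in A `\ zeroRd R d) (p t x)%:E)%E)].

Definition Kd (R : realType) (d : nat) (nu : Rd R d -> R) (r : R) : \bar R :=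
  ((r ^- 2)%:E * \int[@lebRd R d]_(y in [set y | (normRd y <= r)%R]) ((normRd y ^+ 2 * nu y)%R)%:E)%E.

(* Main.v *)
Require Import Defs.
From HB Require Import structures.
From mathcomp Require Import all_boot all_order all_algebra.
From mathcomp Require Import all_classical all_reals all_analysis.
From mathcomp Require Import measurable_realfun lra ring.
Import Order.TTheory GRing.Theory Num.Theory numFieldNormedType.Exports.
Set Implicit Arguments. Unset Strict Implicit. Unset Printing Implicit Defensive.
Local Open Scope classical_set_scope.
Local Open Scope ring_scope.

(** If a function [f >= 0] with [f 0 = 0] has a generator bounded above by [B],
    then Dynkin's formula gives [E f(X_t) <= t B].  Write [r = |x|] and
    [rho = r / sqrt d].  The density at [x] is at most the average of [p t] over
    the box [[rho/2, rho]^d], which lies in the ball of radius [r], so it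
    suffices to find such an [f], bounded below on that box, with
    [B <= C K_d(r)].

    We take [f(x) = prod_i (1 - cos (x_i / rho)) F_N(x_i / rho)] with [F_N] the
    Fejer kernel of period [2 pi N].  This is a finite sum of cosines, so
    Dynkin's formula follows from the characteristic function of [X_t] alone.
    Jumps with [|y| <= r] contribute [O(r^-2 |y|^2)] by Taylor's formula.
    Jumps with [|y| > r] have intensity at most [nu(x)], and the integral of [f]
    over one period is [O(rho^d)]; jumps longer than a period disappear as [N]
    grows.  Finally [nu(x) r^d = O(K_d(r))] by monotonicity.

    The characteristic function is [exp(-t psi)] at every time [t]: it is real
    because the law of [X_t] is symmetric, multiplicative in [t] by independence
    of the increments, and bounded by [1], hence monotone in [t]. *)

(** * Lebesgue measure on R^d *)

Lemma integral_indicM (R : realType) dT (T : measurableType dT)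
    (mu : {measure set T -> \bar R}) (D : set T) (f : T -> R) :
  (\int[mu]_x (\1_D x * f x)%:E = \int[mu]_(x in D) (f x)%:E)%E.
Proof.
rewrite [RHS]integral_mkcond; apply: eq_integral => y _.
by rewrite patchE indicE; case: ifP => yI; rewrite ?mul1r ?mul0r.
Qed.

Section lebRd_measure.
Variable R : realType.

Lemma measurable_consRd d : measurable_fun setT (@consRd R d).
Proof. by apply: measurable_cons => //. Qed.

Lemma measurable_consRd_snd d (a : R) :
  measurable_fun [set: Rd R d] (fun y => consRd (a, y)).
Proof.
exact: (@measurable_cons _ _ (Rd R d) (measurableTypeR R) (fun=> a) d id
  (measurable_cst _) (@measurable_id _ _ _)).
Qed.

Definition unconsRd d (x : Rd R d.+1) : measurableTypeR R * Rd R d :=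
  (thead x, [tuple of behead x]).

Lemma measurable_unconsRd d : measurable_fun setT (@unconsRd d).
Proof.
apply: measurable_fun_pair; first exact: measurable_tnth.
exact: measurable_behead.
Qed.

Lemma consRdK d : cancel (@consRd R d) (@unconsRd d).
Proof.
by move=> [a y]; rewrite /unconsRd/= theadE; congr pair; exact: val_inj.
Qed.

Lemma sigma_finite_measure_pack dT (T : measurableType dT)
    (m : {measure set T -> \bar R}) : sigma_finite setT m ->
  exists m' : {sigma_finite_measure set T -> \bar R}, m = m' :> (set T -> \bar R).
Proof.
move=> sf.
pose H1 := isSFinite.Build _ _ _ _ (sfinite_measure_sigma_finite sf).
pose H2 := isSigmaFinite.Build _ _ _ _ sf.
by exists (HB.pack_for {sigma_finite_measure set T -> \bar R} (Measure.sort m) H1 H2).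
Qed.

(** [lebRd] is a bare set function defined by recursion. Forming the product with one more line
    takes a sigma-finite measure on the remaining coordinates, so the measure structure and
    sigma-finiteness are carried together through the induction. *)
Lemma lebRd_sigma_finite_measure d :
  exists m : {sigma_finite_measure set Rd R d -> \bar R}, @lebRd R d = m.
Proof.
elim: d => [|d [m IHm]].
  by exists (\d_(zeroRd R 0)); apply/funext => A.
have mcons := @measurable_consRd d.
have -> : @lebRd R d.+1 =
    pushforward ((@lebesgue_measure R) \x m)%E (@consRd R d).
  by rewrite /= IHm.
pose f : {mfun _ >-> _} := HB.pack (@consRd R d)
  (isMeasurableFun.Build _ _ _ _ (@consRd R d) mcons).
pose mu := [the {measure set _ -> \bar R} of ((@lebesgue_measure R) \x m)%E].
have sf : sigma_finite setT (pushforward mu f).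
  have /sigma_finiteP[F [TF ndF Foo]] := sigma_finiteT (@lebesgue_measure R).
  have /sigma_finiteP[G [TG ndG Goo]] := sigma_finiteT m.
  (* These preimages are the images of the rectangles under [consRd]. Both exhausting sequences
     increase, so a point caught at indices [n] and [k] is caught at their maximum. *)
  exists (fun n => @unconsRd d @^-1` (F n `*` G n)).
    rewrite -preimage_bigcup; apply/seteqP; split => // x _ /=.
    have : setT (unconsRd x).1 by [].
    rewrite TF => -[n _ Fn]; have : setT (unconsRd x).2 by [].
    rewrite TG => -[k _ Gk]; exists (maxn n k) => //; split.
      by move: Fn; exact/subsetPset/ndF/leq_maxl.
    by move: Gk; exact/subsetPset/ndG/leq_maxr.
  move=> n; have [mF Fn] := Foo n; have [mG Gn] := Goo n; split.
    rewrite -[X in measurable X]setTI; apply: measurable_unconsRd => //.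
    exact: measurableX.
  rewrite /pushforward -comp_preimage (_ : _ \o _ = id); last first.
    by apply/funext => z; exact: consRdK.
  by rewrite /= product_measure1E// lte_mul_pinfty// ge0_fin_numE.
exact: (@sigma_finite_measure_pack _ _
  (measure_function_pushforward__canonical__measure_function_Measure mu mcons)).
Qed.

Let lebRd0 d : @lebRd R d set0 = 0%E.
Proof. by have [m ->] := lebRd_sigma_finite_measure d; exact: measure0. Qed.

Let lebRd_ge0 d (A : set (Rd R d)) : (0 <= @lebRd R d A)%E.
Proof. by have [m ->] := lebRd_sigma_finite_measure d; exact: measure_ge0. Qed.

Let lebRd_sigma_additive d : semi_sigma_additive (@lebRd R d).
Proof.
have [m ->] := lebRd_sigma_finite_measure d.
exact: measure_semi_sigma_additive.
Qed.

HB.instance Definition _ d := isMeasure.Build _ _ _ (@lebRd R d)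
  (@lebRd0 d) (@lebRd_ge0 d) (@lebRd_sigma_additive d).

Let lebRd_sigma_finite d : sigma_finite setT (@lebRd R d).
Proof. by have [m ->] := lebRd_sigma_finite_measure d; exact: sigma_finiteT. Qed.

HB.instance Definition _ d := Measure_isSigmaFinite.Build _ _ _ (@lebRd R d)
  (@lebRd_sigma_finite d).

Local Open Scope ereal_scope.

Lemma lebRdS d : @lebRd R d.+1 =
  pushforward (@lebesgue_measure R \x @lebRd R d) (@consRd R d).
Proof. by []. Qed.

Lemma ge0_integral_lebRdS d (f : Rd R d.+1 -> \bar R) :
  measurable_fun [set: Rd R d.+1] f -> (forall x, 0 <= f x) ->
  \int[@lebRd R d.+1]_x f x =
  \int[@lebesgue_measure R]_a \int[@lebRd R d]_y f (consRd (a, y)).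
Proof.
move=> mf f0.
transitivity (\int[(@lebesgue_measure R \x @lebRd R d)]_z f (consRd z)).
  by rewrite lebRdS ge0_integral_pushforward//; exact: measurable_consRd.
by rewrite fubini_tonelli1//; exact: measurableT_comp (@measurable_consRd d).
Qed.

Lemma measurable_integral_consRd d (f : Rd R d.+1 -> \bar R) :
  measurable_fun [set: Rd R d.+1] f -> (forall x, 0 <= f x) ->
  measurable_fun [set: measurableTypeR R] (fun a => \int[@lebRd R d]_y f (consRd (a, y))).
Proof.
move=> mf f0.
apply: (@measurable_fun_fubini_tonelli_F _ _ _ _ _ _ (f \o @consRd R d)).
  exact: measurableT_comp (@measurable_consRd d).
by move=> z; exact: f0.
Qed.

Lemma integral_lebRd0 (f : Rd R 0 -> \bar R) :
  (forall x, 0 <= f x) -> \int[@lebRd R 0]_x f x = f (zeroRd R 0).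
Proof.
move=> f0; rewrite (_ : @lebRd R 0 = \d_(zeroRd R 0)); last exact/funext.
rewrite integral_dirac// ?diracT ?mul1e//.
rewrite (_ : f = cst (f (zeroRd R 0))) //.
by apply/funext => x /=; rewrite [x]tuple0 [zeroRd R 0]tuple0.
Qed.

Definition oppRd d (x : Rd R d) : Rd R d := [tuple - tnth x i | i < d]%R.

Lemma measurable_oppRd d : measurable_fun setT (@oppRd d).
Proof.
apply/measurable_fun_tnthP => i; rewrite (_ : _ \o _ = fun x => - tnth x i)%R.
  by apply: measurableT_comp => //; exact: measurable_tnth.
by apply/funext => x /=; rewrite tnth_mktuple.
Qed.

Lemma oppRdK d : involutive (@oppRd d).
Proof. by move=> x; apply: eq_from_tnth => i; rewrite !tnth_mktuple opprK. Qed.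

Lemma tnth_consRd0 d a (y : Rd R d) : tnth (consRd (a, y)) ord0 = a.
Proof. by []. Qed.

Lemma tnth_consRdS d a (y : Rd R d) i :
  tnth (consRd (a, y)) (lift ord0 i) = tnth y i.
Proof. by rewrite tnthS. Qed.

Lemma oppRd_consRd d a (y : Rd R d) :
  oppRd (consRd (a, y)) = consRd ((- a)%R, oppRd y).
Proof.
apply: eq_from_tnth => i; rewrite tnth_mktuple.
by have [j ->|->] := unliftP ord0 i; rewrite ?tnth_consRdS ?tnth_mktuple.
Qed.

(** The tail is reflected by the induction hypothesis and the head by reflection invariance of
    Lebesgue measure on the line. This is what makes the law of [X t] symmetric. *)
Lemma integral_lebRdN d (f : Rd R d -> \bar R) :
  measurable_fun [set: Rd R d] f -> (forall x, 0 <= f x) ->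
  \int[@lebRd R d]_x f (oppRd x) = \int[@lebRd R d]_x f x.
Proof.
elim: d f => [|d IHd] f mf f0.
  by rewrite !integral_lebRd0//; congr f; rewrite [LHS]tuple0 [RHS]tuple0.
rewrite !ge0_integral_lebRdS//; last exact: measurableT_comp (@measurable_oppRd _).
transitivity (\int[@lebesgue_measure R]_a \int[@lebRd R d]_y
    f (consRd ((- a)%R, y))).
  apply: eq_integral => a _; rewrite -[RHS]IHd//; last first.
    exact: (measurableT_comp mf (@measurable_consRd_snd d (- a)%R)).
  by apply: eq_integral => y _; rewrite oppRd_consRd.
have mN : measurable_fun setT (-%R : measurableTypeR R -> measurableTypeR R).
  by [].
pose F (a : measurableTypeR R) := \int[@lebRd R d]_y f (consRd (a, y)).
rewrite -[LHS](@ge0_integral_pushforward _ _ _ _ _ _ mN _ setT F)//.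
- by apply: eq_measure_integral => A mA _; exact: lebesgue_measureN.
- exact: measurable_integral_consRd.
- by move=> a _; exact: integral_ge0.
Qed.

(** Iterated Tonelli. It serves both for the volume of a box and for the integral of the test
    function over a period window. *)
Lemma integral_lebRd_prod d (h : 'I_d -> R -> R) (m : 'I_d -> R) :
  (forall i, measurable_fun setT (h i)) -> (forall i a, 0 <= h i a)%R ->
  (forall i, \int[@lebesgue_measure R]_a (h i a)%:E = (m i)%:E) ->
  \int[@lebRd R d]_y (\prod_(i < d) h i (tnth y i))%:E = (\prod_(i < d) m i)%:E.
Proof.
elim: d h m => [|d IHd] h m mh h0 hm.
  by rewrite integral_lebRd0 => [|x]; rewrite ?big_ord0.
have mprod n (g : 'I_n -> R -> R) : (forall i, measurable_fun setT (g i)) ->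
    measurable_fun [set: Rd R n] (fun y : Rd R n => \prod_(i < n) g i (tnth y i))%R.
  move=> mg; apply: measurable_prod => i _.
  exact: measurableT_comp (mg i) (measurable_tnth i).
rewrite ge0_integral_lebRdS; last 2 first.
  by apply/measurable_EFinP; exact: (mprod _ h).
  by move=> x; rewrite lee_fin prodr_ge0.
under eq_integral => a _.
  under eq_integral => y _.
    rewrite big_ord_recl tnth_consRd0 EFinM.
    under eq_bigr => i _ do rewrite tnth_consRdS.
    over.
  rewrite ge0_integralZl//; last 3 first.
  - by apply/measurable_EFinP; exact: (mprod _ (fun i => h (lift ord0 i))).
  - by move=> y _; rewrite lee_fin prodr_ge0.
  - by rewrite lee_fin.
  rewrite (IHd (fun i => h (lift ord0 i)) (fun i => m (lift ord0 i)))//.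
  over.
rewrite /= ge0_integralZr//; last 3 first.
- by apply/measurable_EFinP; exact: mh.
- by move=> a _; rewrite lee_fin.
- rewrite lee_fin prodr_ge0// => i _.
  by rewrite -lee_fin -hm integral_ge0// => a _; rewrite lee_fin.
by rewrite hm big_ord_recl EFinM.
Qed.

End lebRd_measure.

(** * Trigonometric polynomials *)

Section trig_inequalities.
Variable R : realType.
Implicit Types u v : R.

Lemma sin_normle u : `|sin u| <= `|u|.
Proof.
wlog u0 : u / 0 <= u.
  move=> H; have [/H//|/ltW u0] := leP 0 u.
  by rewrite -normrN -sinN -[leRHS]normrN H// oppr_ge0.
have [|c _] := @MVT_segment R sin cos 0 u u0 (fun x _ => is_derive_sin x).
  exact/continuous_subspaceT/continuous_sin.
by rewrite sin0 !subr0 => ->; rewrite normrM ler_piMl// cos_max.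
Qed.

Lemma one_minus_cosE u : 1 - cos u = sin (u / 2) ^+ 2 *+ 2.
Proof.
rewrite [in LHS](_ : u = (u / 2) *+ 2); last by rewrite -mulr_natr mulfVK// pnatr_eq0.
by rewrite cos_mulr2n sin2cos2; ring.
Qed.

Lemma one_minus_cos_ge0 u : 0 <= 1 - cos u.
Proof. by rewrite subr_ge0 cos_le1. Qed.

Lemma one_minus_cos_le u : 1 - cos u <= u ^+ 2 / 2.
Proof.
rewrite one_minus_cosE -(real_normK (num_real (sin _))).
have : `|sin (u / 2)| ^+ 2 <= `|u / 2| ^+ 2.
  by rewrite ler_sqr ?nnegrE// sin_normle.
rewrite (real_normK (num_real (u / 2))); set s := `|_| ^+ 2 => h.
by rewrite (_ : u ^+ 2 / 2 = (u / 2) ^+ 2 *+ 2); [rewrite lerMn2r h orbT|field].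
Qed.

Lemma cosM u v : cos u * cos v = (cos (u + v) + cos (u - v)) / 2.
Proof. by rewrite cosD cosB; field. Qed.

Lemma sin_pi_natmul n : sin (pi * n%:R) = 0 :> R.
Proof.
elim: n => [|n IHn]; first by rewrite mulr0 sin0.
by rewrite -natr1 mulrDr mulr1 sinDpi IHn oppr0.
Qed.

Lemma sin_pi_subn (j k : nat) : sin (pi * (j%:R - k%:R)) = 0 :> R.
Proof. by rewrite mulrBr sinB !sin_pi_natmul mul0r mulr0 subrr. Qed.

Lemma measurable_cosR : measurable_fun [set: R] (@cos R).
Proof. by apply: continuous_measurable_fun; exact: continuous_cos. Qed.

End trig_inequalities.

Section trigonometric_polynomials.
Variables (R : realType) (d : nat).
Implicit Types (x y z xi : Rd R d) (f : Rd R d -> R).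

Definition addRd x y : Rd R d := [tuple tnth x i + tnth y i | i < d].

Definition axisRd (i : 'I_d) (c : R) : Rd R d :=
  [tuple (if j == i then c else 0) | j < d].

Lemma dotRdDl xi y x : dotRd (addRd xi y) x = dotRd xi x + dotRd y x.
Proof.
rewrite /dotRd -big_split/=; apply: eq_bigr => i _.
by rewrite tnth_mktuple mulrDl.
Qed.

Lemma dotRdBl xi y x : dotRd (subRd xi y) x = dotRd xi x - dotRd y x.
Proof.
rewrite /dotRd -sumrB; apply: eq_bigr => i _.
by rewrite tnth_mktuple mulrBl.
Qed.

Lemma dotRdDr xi y x : dotRd xi (addRd x y) = dotRd xi x + dotRd xi y.
Proof.
rewrite /dotRd -big_split/=; apply: eq_bigr => i _.
by rewrite tnth_mktuple mulrDr.
Qed.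

Lemma dotRdBr xi y x : dotRd xi (subRd x y) = dotRd xi x - dotRd xi y.
Proof.
rewrite /dotRd -sumrB; apply: eq_bigr => i _.
by rewrite tnth_mktuple mulrBr.
Qed.

Lemma dotRd0r xi : dotRd xi (zeroRd R d) = 0.
Proof. by rewrite /dotRd big1// => i _; rewrite tnth_mktuple mulr0. Qed.

Lemma dotRd0l x : dotRd (zeroRd R d) x = 0.
Proof. by rewrite /dotRd big1// => i _; rewrite tnth_mktuple mul0r. Qed.

Lemma dotRd_axis i c x : dotRd (axisRd i c) x = c * tnth x i.
Proof.
rewrite /dotRd (bigD1 i)//= tnth_mktuple eqxx big1 ?addr0// => j ji.
by rewrite tnth_mktuple (negPf ji) mul0r.
Qed.

Lemma normRd_ge0 x : 0 <= normRd x. Proof. exact: sqrtr_ge0. Qed.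

Lemma normRd_sqr x : normRd x ^+ 2 = \sum_(i < d) tnth x i ^+ 2.
Proof. by rewrite sqr_sqrtr// sumr_ge0// => i _; exact: sqr_ge0. Qed.

Lemma tnth_normRd x i : `|tnth x i| <= normRd x.
Proof.
rewrite -(@ler_sqr R) ?nnegrE ?normRd_ge0// normRd_sqr real_normK ?num_real//.
by rewrite (bigD1 i)//= lerDl sumr_ge0// => j _; exact: sqr_ge0.
Qed.

Lemma normr_dotRd xi x : `|dotRd xi x| <= (\sum_(i < d) `|tnth xi i|) * normRd x.
Proof.
apply: le_trans (ler_norm_sum _ _ _) _; rewrite mulr_suml; apply: ler_sum => i _.
by rewrite normrM ler_wpM2l// tnth_normRd.
Qed.

(** An entry of the list is amplitude, frequency vector, phase. The explicit list allows
    expectations and the generator to be computed term by term. *)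
Definition trig_eval (s : seq (R * Rd R d * R)) x : R :=
  \sum_(j <- s) j.1.1 * cos (dotRd j.1.2 x + j.2).

(* [A] bounds the sum of the amplitudes and [L] the frequencies. *)
Definition trigpoly (A L : R) f := exists s : seq (R * Rd R d * R),
  [/\ f =1 trig_eval s, \sum_(j <- s) `|j.1.1| <= A &
      forall j, j \in s -> forall y, `|dotRd j.1.2 y| <= L * normRd y].

Lemma trigpoly_cst c : trigpoly `|c| 0 (fun=> c).
Proof.
exists [:: (c, zeroRd R d, 0)]; split=> [x||j]; rewrite ?/trig_eval ?big_seq1//=.
  by rewrite dotRd0l addr0 cos0 mulr1.
by rewrite inE => /eqP-> y /=; rewrite dotRd0l normr0 mul0r.
Qed.

Lemma trigpoly_cos xi th L : (forall y, `|dotRd xi y| <= L * normRd y) ->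
  trigpoly 1 L (fun x => cos (dotRd xi x + th)).
Proof.
move=> xiL; exists [:: (1, xi, th)]; split=> [x||j].
- by rewrite /trig_eval big_seq1/= mul1r.
- by rewrite big_seq1/= normr1.
- by rewrite inE => /eqP->.
Qed.

Lemma trigpolyD A1 A2 L f1 f2 : trigpoly A1 L f1 -> trigpoly A2 L f2 ->
  trigpoly (A1 + A2) L (fun x => f1 x + f2 x).
Proof.
move=> [s1 [f1E A1s L1s]] [s2 [f2E A2s L2s]]; exists (s1 ++ s2); split.
- by move=> x; rewrite f1E f2E /trig_eval big_cat.
- by rewrite big_cat/= lerD.
- by move=> j; rewrite mem_cat => /orP[/L1s//|/L2s].
Qed.

Lemma trigpolyZ A L f c : trigpoly A L f -> trigpoly (`|c| * A) L (fun x => c * f x).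
Proof.
move=> [s [fE As Ls]]; exists [seq (c * j.1.1, j.1.2, j.2) | j <- s]; split.
- move=> x; rewrite fE /trig_eval big_map mulr_sumr.
  by apply: eq_bigr => j _; rewrite mulrA.
- rewrite big_map/= (eq_bigr (fun j => `|c| * `|j.1.1|)); last first.
    by move=> j _; rewrite normrM.
  by rewrite -mulr_sumr ler_wpM2l.
- by move=> j /mapP[k ks ->]/=; exact: Ls.
Qed.

(** The product-to-sum formula turns each term into two terms of half the amplitude, so the total
    amplitude is unchanged while the frequency bounds add. *)
Lemma trigpoly_cosM A L1 L2 xi th f : (forall y, `|dotRd xi y| <= L1 * normRd y) ->
  trigpoly A L2 f -> trigpoly A (L1 + L2) (fun x => cos (dotRd xi x + th) * f x).
Proof.
move=> xiL [s [fE As Ls]].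
exists ([seq (j.1.1 / 2, addRd xi j.1.2, th + j.2) | j <- s] ++
        [seq (j.1.1 / 2, subRd xi j.1.2, th - j.2) | j <- s]); split.
- move=> x; rewrite fE /trig_eval big_cat/= !big_map -big_split mulr_sumr/=.
  apply: eq_bigr => j _; rewrite dotRdDl dotRdBl mulrCA cosM.
  rewrite (_ : dotRd xi x + th + _ = dotRd xi x + dotRd j.1.2 x + (th + j.2)); last by ring.
  rewrite (_ : dotRd xi x + th - _ = dotRd xi x - dotRd j.1.2 x + (th - j.2)); last by ring.
  by field.
- rewrite big_cat/= !big_map -big_split/=; apply: le_trans As.
  apply: ler_sum => j _; rewrite normrM -mulrDr ler_piMr// ger0_norm ?invr_ge0//.
  lra.
- move=> j; rewrite mem_cat => /orP[] /mapP[k ks ->]/= y.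
    rewrite dotRdDl (le_trans (ler_normD _ _))// mulrDl lerD//; exact: Ls.
  rewrite dotRdBl (le_trans (ler_normB _ _))// mulrDl lerD//; exact: Ls.
Qed.

Lemma trigpolyW A A' L L' f : A <= A' -> L <= L' ->
  trigpoly A L f -> trigpoly A' L' f.
Proof.
move=> AA' LL' [s [fE As Ls]]; exists s; split => //; first exact: le_trans AA'.
by move=> j /Ls H y; apply: le_trans (H y) _; rewrite ler_wpM2r// normRd_ge0.
Qed.

Lemma trigpoly_eq A L f g : f =1 g -> trigpoly A L f -> trigpoly A L g.
Proof. by move=> /funext->. Qed.

Lemma trigpolyM A1 A2 L1 L2 f1 f2 : 0 <= A2 ->
  trigpoly A1 L1 f1 -> trigpoly A2 L2 f2 ->
  trigpoly (A1 * A2) (L1 + L2) (fun x => f1 x * f2 x).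
Proof.
move=> A20 [s1 [f1E A1s L1s]] f2P.
(* With the exact sum of amplitudes in place of [A1], the bound splits along the list and induction
   applies. *)
suff H : trigpoly ((\sum_(j <- s1) `|j.1.1|) * A2) (L1 + L2)
    (fun x => trig_eval s1 x * f2 x).
  apply: (@trigpoly_eq _ _ (fun x => trig_eval s1 x * f2 x)) => [x|].
    by rewrite f1E.
  by apply: trigpolyW H => //; rewrite ler_wpM2r.
elim: s1 L1s {f1E A1s f1} => [|j s1 IHs] L1s.
  exists [::]; split => [x||//]; last by rewrite !big_nil mul0r.
  by rewrite /trig_eval !big_nil mul0r.
rewrite big_cons mulrDl.
apply: (@trigpoly_eq _ _ (fun x =>
    j.1.1 * (cos (dotRd j.1.2 x + j.2) * f2 x) + trig_eval s1 x * f2 x)).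
  by move=> x; rewrite /trig_eval big_cons mulrDl mulrA.
apply: trigpolyD; last by apply: IHs => k ks; apply: L1s; rewrite inE ks orbT.
by apply/trigpolyZ/trigpoly_cosM => //; apply: L1s; rewrite mem_head.
Qed.

Lemma trigpoly_sum I (s : seq I) A L (F : I -> Rd R d -> R) :
  (forall i, trigpoly A L (F i)) ->
  trigpoly (A *+ size s) L (fun x => \sum_(i <- s) F i x).
Proof.
move=> FP; elim: s => [|i s IHs].
  exists [::]; split => [x||//]; last by rewrite big_nil mulr0n.
  by rewrite /trig_eval !big_nil.
apply: (@trigpoly_eq _ _ (fun x => F i x + \sum_(j <- s) F j x)).
  by move=> x; rewrite big_cons.
by rewrite /= mulrS; exact: trigpolyD.
Qed.

Lemma trigpoly_prod I (s : seq I) A L (F : I -> Rd R d -> R) : 0 <= A ->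
  (forall i, trigpoly A L (F i)) ->
  trigpoly (A ^+ size s) (L *+ size s) (fun x => \prod_(i <- s) F i x).
Proof.
move=> A0 FP; elim: s => [|i s IHs].
  apply: (@trigpoly_eq _ _ (fun=> 1)) => [x|]; first by rewrite big_nil.
  by rewrite expr0 mulr0n -[X in trigpoly X](normr1 R); exact: trigpoly_cst.
apply: (@trigpoly_eq _ _ (fun x => F i x * \prod_(j <- s) F j x)).
  by move=> x; rewrite big_cons.
by rewrite /= exprS mulrS; apply: trigpolyM => //; rewrite exprn_ge0.
Qed.

Lemma trigpoly_le A L f x : trigpoly A L f -> `|f x| <= A.
Proof.
move=> [s [-> As _]]; apply: le_trans As; apply: le_trans (ler_norm_sum _ _ _) _.
by apply: ler_sum => j _; rewrite normrM ler_piMr// cos_max.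
Qed.

(* The integrand of the generator of a symmetric Levy process. *)
Definition symdiff f z y := (f (addRd z y) + f (subRd z y)) / 2 - f z.

(** By the addition formulas the sine parts cancel in the symmetrization, so a cosine of frequency
    [xi] is an eigenfunction with factor [cos (dotRd xi y) - 1]. *)
Lemma symdiff_trig_eval s z y : symdiff (trig_eval s) z y =
  \sum_(j <- s) - (j.1.1 * cos (dotRd j.1.2 z + j.2)) * (1 - cos (dotRd j.1.2 y)).
Proof.
rewrite /symdiff /trig_eval -big_split/= mulr_suml -sumrB; apply: eq_bigr => j _.
rewrite dotRdDr dotRdBr (addrAC _ (dotRd _ y)) (addrAC _ (- dotRd _ y)).
by rewrite (cosD (_ + _)) (cosB (_ + _)); field.
Qed.

(** Second-order Taylor bound: [1 - cos u <= u ^+ 2 / 2] with [u] at most [L * normRd y] in each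
    term, summed against the amplitudes. *)
Lemma symdiff_le A L f z y : 0 <= L -> trigpoly A L f ->
  symdiff f z y <= A * L ^+ 2 / 2 * normRd y ^+ 2.
Proof.
move=> L0 [s [/funext-> As Ls]]; rewrite symdiff_trig_eval.
have K0 : 0 <= L ^+ 2 / 2 * normRd y ^+ 2.
  by rewrite mulr_ge0 ?divr_ge0 ?exprn_ge0 ?normRd_ge0.
apply: (@le_trans _ _ ((\sum_(j <- s) `|j.1.1|) * (L ^+ 2 / 2 * normRd y ^+ 2))).
  rewrite mulr_suml big_seq [leRHS]big_seq; apply: ler_sum => j js.
  apply: le_trans (ler_norm _) _; rewrite normrM normrN normrM.
  rewrite -mulrA ler_wpM2l// (ger0_norm (one_minus_cos_ge0 _)).
  apply: (@le_trans _ _ (1 - cos (dotRd j.1.2 y))).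
    by rewrite ler_piMl ?one_minus_cos_ge0 ?cos_max.
  apply: le_trans (one_minus_cos_le _) _; rewrite [leRHS]mulrAC ler_wpM2r ?invr_ge0//.
  rewrite -exprMn -(real_normK (num_real (dotRd _ _))) ler_sqr ?nnegrE ?Ls//.
  by rewrite mulr_ge0// normRd_ge0.
by rewrite -[leRHS]mulrA -[leRHS]mulrA [X in A * X]mulrA ler_wpM2r.
Qed.

Lemma measurable_dotRd xi : measurable_fun [set: Rd R d] (dotRd xi).
Proof.
apply: measurable_sum => i; apply: measurable_funM => //.
exact: measurable_tnth.
Qed.

Lemma measurable_cos_dotRd xi th :
  measurable_fun [set: Rd R d] (fun x => cos (dotRd xi x + th)).
Proof.
apply: (measurableT_comp (@measurable_cosR R)).
by apply: measurable_funD => //; exact: measurable_dotRd.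
Qed.

Lemma measurable_trigpoly A L f : trigpoly A L f -> measurable_fun [set: Rd R d] f.
Proof.
move=> [s [/funext-> _ _]]; apply: measurable_sum => j; apply: measurable_funM => //.
exact: measurable_cos_dotRd.
Qed.

Lemma measurable_normRd : measurable_fun [set: Rd R d] (@normRd R d).
Proof.
have msqrt : measurable_fun [set: R] (@Num.sqrt R).
  by apply: continuous_measurable_fun; exact: sqrt_continuous.
apply: (measurableT_comp msqrt).
apply: measurable_sum => i; apply: measurable_funX; exact: measurable_tnth.
Qed.

Lemma measurable_addRd z : measurable_fun [set: Rd R d] (addRd z).
Proof.
apply/measurable_fun_tnthP => i; rewrite (_ : _ \o _ = fun x => tnth z i + tnth x i).
  by apply: measurable_funD => //; exact: measurable_tnth.
by apply/funext => x /=; rewrite tnth_mktuple.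
Qed.

Lemma measurable_subRd z : measurable_fun [set: Rd R d] (subRd z).
Proof.
apply/measurable_fun_tnthP => i; rewrite (_ : _ \o _ = fun x => tnth z i - tnth x i).
  by apply: measurable_funB => //; exact: measurable_tnth.
by apply/funext => x /=; rewrite tnth_mktuple.
Qed.

End trigonometric_polynomials.

(** * Fejer kernels *)

Section fejer_kernel.
Variable R : realType.
Implicit Types (u v c th L e a rho : R) (N : nat).

(** For positive [N] the value at the origin is 1. The mean over a period [2 * pi * N] comes from
    the diagonal [j = k] and is [1 / N], so the integral over a period is [2 * pi], whatever [N]
    is. *)
Definition fejer N u : R := N%:R ^- 2 *
  \sum_(j < N) \sum_(k < N) cos ((j%:R - k%:R) * (u / N%:R)).

Definition fbump N u : R := (1 - cos u) * fejer N u.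

(** This is the squared modulus of the exponential mean with angles [j * u / N], split into real and
    imaginary parts. It yields both positivity and the lower bound near the origin. *)
Lemma fejerE N u : fejer N u =
  (N%:R^-1 * \sum_(j < N) cos (j%:R * (u / N%:R))) ^+ 2 +
  (N%:R^-1 * \sum_(j < N) sin (j%:R * (u / N%:R))) ^+ 2.
Proof.
rewrite /fejer !exprMn -mulrDr exprVn; congr (_ * _).
rewrite !expr2 !mulr_suml -big_split/=; apply: eq_bigr => j _.
rewrite !mulr_sumr -big_split/=; apply: eq_bigr => k _.
by rewrite mulrBl cosB.
Qed.

Lemma fejer_ge0 N u : 0 <= fejer N u.
Proof. by rewrite fejerE addr_ge0 ?sqr_ge0. Qed.

Lemma bump_ge0 N u : 0 <= fbump N u.
Proof. by rewrite mulr_ge0 ?fejer_ge0 ?one_minus_cos_ge0. Qed.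

Lemma bump0 N : fbump N 0 = 0.
Proof. by rewrite /fbump cos0 subrr mul0r. Qed.

Lemma cos_anti u v : 0 <= u -> u <= v -> v <= 1 -> cos v <= cos u.
Proof.
move=> u0 uv v1; have := @pi_ge2 R => pi2.
rewrite leNgt ltr_cos ?in_itv/=; last 2 first.
- by apply/andP; split; lra.
- by apply/andP; split; lra.
by rewrite -leNgt.
Qed.

(** All angles [j * u / N] lie between 0 and 1, so the mean of their cosines is at least [cos 1];
    the squared sine mean is dropped. *)
Lemma fejer_ge N u : (0 < N)%N -> 0 <= u <= 1 -> cos 1 ^+ 2 <= fejer N u.
Proof.
move=> N0 /andP[u0 u1]; rewrite fejerE.
have NR0 : 0 < N%:R :> R by rewrite ltr0n.
have c1 := @cos1_gt0 R.
suff : cos 1 <= N%:R^-1 * \sum_(j < N) cos (j%:R * (u / N%:R)).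
  move=> h; apply: (@le_trans _ _ ((N%:R^-1 * \sum_(j < N) cos (j%:R * (u / N%:R))) ^+ 2)).
    by rewrite ler_sqr// nnegrE ltW// (lt_le_trans c1).
  by rewrite lerDl sqr_ge0.
rewrite ler_pdivlMl// mulr_natl -[X in _ *+ X]card_ord -sumr_const.
apply: ler_sum => j _; rewrite mulrCA; apply: cos_anti => //.
- by rewrite mulr_ge0// divr_ge0.
- rewrite mulr_ile1// ?divr_ge0// ler_pdivrMr// mul1r ler_nat; exact: ltnW.
Qed.

(** The product of the lower bounds of the two factors of [fbump] for [u] between 1/2 and 1; it does
    not depend on [N]. *)
Definition bump_min : R := (1 - cos 2^-1) * cos 1 ^+ 2.

Lemma bump_min_gt0 : 0 < bump_min.
Proof.
rewrite mulr_gt0 ?exprn_gt0 ?cos1_gt0// subr_gt0 -[ltRHS]cos0.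
have := @pi_ge2 R => pi2.
by rewrite ltr_cos ?in_itv/= ?lexx ?pi_ge0 ?invr_gt0 ?invr_ge0//=; lra.
Qed.

Lemma bump_ge N u : (0 < N)%N -> 2^-1 <= u <= 1 -> bump_min <= fbump N u.
Proof.
move=> N0 /andP[u2 u1].
have u0 : 0 <= u by apply: le_trans u2; rewrite invr_ge0.
apply: ler_pM; rewrite ?sqr_ge0 ?one_minus_cos_ge0//.
  by rewrite lerD2l lerN2; exact: cos_anti.
by apply: fejer_ge => //; rewrite u0.
Qed.

Lemma bump_le N u : fbump N u <= 2 * fejer N u.
Proof.
by rewrite ler_wpM2r ?fejer_ge0//; have := cos_geN1 u; lra.
Qed.

Lemma measurable_fejer N : measurable_fun [set: R] (fejer N).
Proof.
apply: measurable_funM => //; apply: measurable_sum => j.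
apply: measurable_sum => k; apply: (measurableT_comp (@measurable_cosR R)).
by apply: measurable_funM => //; exact: measurable_funM.
Qed.

Lemma measurable_bump N : measurable_fun [set: R] (fbump N).
Proof.
apply: measurable_funM; last exact: measurable_fejer.
by apply: measurable_funB => //; exact: (@measurable_cosR R).
Qed.

(** The primitive [c^-1 * sin (c * y + th)] changes across the interval by a multiple of
    [sin (c * L)]. *)
Lemma integral_cos_period c th L : 0 < L -> c != 0 -> sin (c * L) = 0 ->
  (\int[@lebesgue_measure R]_(y in `[(- L)%R, L]) (cos (c * y + th))%:E = 0)%E.
Proof.
move=> L0 c0 scL.
pose F y := c^-1 * sin (c * y + th).
have dF (y : R) : is_derive y (1 : R) F (cos (c * y + th)).
  have h : is_derive y (1 : R) (fun y : R => c * y + th) c.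
    by apply: is_derive_eq; rewrite addr0 /GRing.scale/= mulr1.
  have := @is_derive1_comp R sin _ y _ _ (is_derive_sin _) h.
  move=> /(@is_deriveZ _ _ _ _ c^-1) /is_derive_eq; apply.
  by rewrite /GRing.scale/= mulrCA mulVf ?mulr1.
have cF : continuous F.
  move=> y; apply: differentiable_continuous; apply/derivable1_diffP.
  exact: ex_derive.
rewrite (@continuous_FTC2 _ _ F)//.
- rewrite -EFinB /F mulrN -mulrBr !sinD cosN sinN scL.
  by rewrite oppr0 !mul0r !add0r subrr mulr0.
- by rewrite gtrN.
- apply: continuous_subspaceT => y; apply: continuous_comp; last exact: continuous_cos.
  by apply: cvgD; [apply: cvgMr; exact: cvg_id|exact: cvg_cst].
- split; first by move=> y _; exact: ex_derive.
    exact/cvg_at_right_filter/cF.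
  exact/cvg_at_left_filter/cF.
- by move=> y _; rewrite derive1E derive_val.
Qed.

Lemma continuous_cos_affine c th : continuous (fun y => cos (c * y + th)).
Proof.
move=> y; apply: continuous_comp; last exact: continuous_cos.
by apply: cvgD; [apply: cvgMr; exact: cvg_id|exact: cvg_cst].
Qed.

Lemma integrable_cos_affine c th L : (@lebesgue_measure R).-integrable
  `[(- L)%R, L] (fun y => (cos (c * y + th))%:E).
Proof.
apply: continuous_compact_integrable; first exact: segment_compact.
exact/continuous_subspaceT/continuous_cos_affine.
Qed.

(** Off-diagonal cosines integrate to zero over a full period. The [N] diagonal ones give [2 * L]
    each, and [N * 2 * L / N ^ 2 = 2 * pi * rho]. The shift [a] and the sign [e] are there for the
    translates by [z + y] and [z - y]. *)
Lemma integral_fejer_period N e a rho : (0 < N)%N -> 0 < rho -> `|e| = 1 ->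
  (\int[@lebesgue_measure R]_(y in `[(- (pi * N%:R * rho))%R, (pi * N%:R * rho)%R])
     (fejer N ((a + e * y) / rho))%:E = (2 * pi * rho)%:E)%E.
Proof.
move=> N0 rho0 e1; set L := pi * N%:R * rho.
have NR0 : N%:R != 0 :> R by rewrite pnatr_eq0 -lt0n.
have L0 : 0 < L by rewrite !mulr_gt0 ?pi_gt0 ?ltr0n.
pose c (j k : 'I_N) := (j%:R - k%:R) * e / (rho * N%:R).
pose th (j k : 'I_N) := (j%:R - k%:R) * a / (rho * N%:R).
have cE y : fejer N ((a + e * y) / rho) = N%:R ^- 2 *
    \sum_(j < N) \sum_(k < N) cos (c j k * y + th j k).
  congr (_ * _); apply: eq_bigr => j _; apply: eq_bigr => k _; congr cos.
  by rewrite /c /th; field; rewrite NR0 lt0r_neq0.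
under eq_integral do rewrite cE EFinM -sumEFin.
have ic j k := @integrable_cos_affine (c j k) (th j k) L.
have icc j : (@lebesgue_measure R).-integrable `[(- L)%R, L]
    (fun y => (\sum_(k < N) cos (c j k * y + th j k))%:E).
  have -> : (fun y => (\sum_(k < N) cos (c j k * y + th j k))%:E) =
     (fun y => \sum_(k < N) (cos (c j k * y + th j k))%:E)%E.
    by apply/funext => y; rewrite sumEFin.
  by apply: integrable_sum => // k _; exact: ic.
rewrite integralZl//; last by apply: integrable_sum => // j _; exact: icc.
rewrite integral_sum//.
have -> : (\sum_(j < N) \int[@lebesgue_measure R]_(y in `[(- L)%R, L])
    (\sum_(k < N) cos (c j k * y + th j k))%:E = \sum_(j < N) (2 * L)%:E)%E.
  apply: eq_bigr => j _.
  under eq_integral do rewrite -sumEFin.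
  rewrite integral_sum// (bigD1 j)//= big1 => [|k kj].
    rewrite adde0; under eq_integral do
      rewrite /c /th subrr !mul0r addr0 cos0.
    rewrite integral_cst//= lebesgue_measure_itv/= lte_fin gtrN// mul1e.
    by rewrite -EFinB opprK; congr EFin; ring.
  apply: integral_cos_period => //.
    have jk0 : j%:R - k%:R != 0 :> R by rewrite subr_eq0 eqr_nat eq_sym.
    have e0 : e != 0 by rewrite -normr_eq0 e1 oner_eq0.
    have rhon0 : rho != 0 by rewrite lt0r_neq0.
    by apply: mulf_neq0; [exact: mulf_neq0|rewrite invr_neq0// mulf_neq0].
  have -> : c j k * L = e * (pi * (j%:R - k%:R)).
    by rewrite /c /L; field; rewrite NR0 lt0r_neq0.
  (* Either sign turns [c j k * L] into an integer multiple of [pi], where the sine vanishes. *)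
  have [->|->] : e = 1 \/ e = -1.
    have [e0|e0] := leP 0 e; first by left; rewrite -e1 ger0_norm.
    by right; rewrite -e1 ltr0_norm ?opprK.
    by rewrite mul1r sin_pi_subn.
  by rewrite mulN1r sinN sin_pi_subn oppr0.
rewrite sumEFin -EFinM; congr EFin; rewrite sumr_const card_ord /L -mulr_natr.
by field.
Qed.

(** Since [1 - cos] is at most 2, the bump costs at most twice the Fejer integral. The value is
    exhibited as a real [m] because [integral_lebRd_prod] takes real one-dimensional integrals. *)
Lemma integral_bump_window N e a rho : (0 < N)%N -> 0 < rho -> `|e| = 1 ->
  exists2 m, (\int[@lebesgue_measure R]_y
    (\1_(`[(- (pi * N%:R * rho))%R, (pi * N%:R * rho)%R]%classic) y *
      fbump N ((a + e * y) / rho))%:E = m%:E)%E & 0 <= m <= 4 * pi * rho.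
Proof.
move=> N0 rho0 e1; set I := `[_, _]%classic.
have mI : measurable I by exact: measurable_itv.
have maff : measurable_fun [set: R] (fun y => (a + e * y) / rho).
  by apply: measurable_funM => //; apply: measurable_funD => //; exact: measurable_funM.
have mb : measurable_fun [set: R] (fun y => fbump N ((a + e * y) / rho)).
  exact: measurableT_comp (measurable_bump N) maff.
have mf : measurable_fun [set: R] (fun y => fejer N ((a + e * y) / rho)).
  exact: measurableT_comp (measurable_fejer N) maff.
have -> : (\int[@lebesgue_measure R]_y (\1_I y * fbump N ((a + e * y) / rho))%:E =
    \int[@lebesgue_measure R]_(y in I) (fbump N ((a + e * y) / rho))%:E)%E.
  exact: integral_indicM.
have le4 : (\int[@lebesgue_measure R]_(y in I) (fbump N ((a + e * y) / rho))%:E <=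
    (4 * pi * rho)%:E)%E.
  apply: (@le_trans _ _ (\int[@lebesgue_measure R]_(y in I)
      (2%:E * (fejer N ((a + e * y) / rho))%:E))%E).
    apply: ge0_le_integral => //.
    - by move=> y _; rewrite lee_fin bump_ge0.
    - by apply/measurable_EFinP; exact: measurable_funTS.
    - apply/measurable_EFinP; apply: measurable_funM => //; exact: measurable_funTS.
    - by move=> y _; rewrite -EFinM lee_fin bump_le.
  rewrite ge0_integralZl//; last 2 first.
  - by apply/measurable_EFinP; exact: measurable_funTS.
  - by move=> y _; rewrite lee_fin fejer_ge0.
  by rewrite integral_fejer_period// -EFinM lee_fin; lra.
have ge0 : (0 <= \int[@lebesgue_measure R]_(y in I) (fbump N ((a + e * y) / rho))%:E)%E.
  by apply: integral_ge0 => y _; rewrite lee_fin bump_ge0.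
move: ge0 le4; case: (integral _ _ _) => [m||]//; rewrite !lee_fin => m0 m4.
by exists m => //; rewrite m0.
Qed.

Lemma size_index_enum_ord n : size (index_enum 'I_n) = n.
Proof. by rewrite -sum1_size big_const_ord iter_addn_0 mul1n. Qed.

Variable d : nat.

Definition bumpRd N rho (x : Rd R d) : R := \prod_(i < d) fbump N (tnth x i / rho).

Lemma bumpRd_ge0 N rho x : 0 <= bumpRd N rho x.
Proof. by rewrite prodr_ge0// => i _; exact: bump_ge0. Qed.

Lemma bumpRd0 N rho : (0 < d)%N -> bumpRd N rho (zeroRd R d) = 0.
Proof.
move=> d0; rewrite /bumpRd (bigD1 (Ordinal d0))//= tnth_mktuple mul0r bump0.
by rewrite mul0r.
Qed.

(** In each coordinate [1 - cos] has total amplitude 2 and the Fejer factor total amplitude 1, as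
    [N ^ 2] terms of weight [N ^- 2]. Both have frequencies at most [rho^-1], since [j] and [k]
    differ by at most [N]. Hence neither bound depends on [N]. *)
Lemma trigpoly_bumpRd N rho : (0 < N)%N -> 0 < rho ->
  trigpoly (2 ^+ d) (2 / rho *+ d) (bumpRd N rho).
Proof.
move=> N0 rho0.
have NR0 : 0 < N%:R :> R by rewrite ltr0n.
have P i : trigpoly 2 (2 / rho) (fun x : Rd R d => fbump N (tnth x i / rho)).
  have axisP c : `|c| <= rho^-1 ->
      forall y, `|dotRd (axisRd i c) y| <= rho^-1 * normRd y.
    by move=> crho y; rewrite dotRd_axis normrM ler_pM// tnth_normRd.
  have P1 : trigpoly 2 rho^-1 (fun x : Rd R d => 1 - cos (tnth x i / rho)).
    have := trigpolyD (trigpolyW (lexx _) _ (trigpoly_cst d 1))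
      (trigpolyZ (-1) (trigpoly_cos 0 (axisP rho^-1 _))).
    have rhoV : 0 <= rho^-1 by rewrite invr_ge0 ltW.
    rewrite (ger0_norm rhoV) => /(_ rhoV (lexx _)).
    rewrite normrN !normr1 mulr1.
    apply: trigpoly_eq => x.
    by rewrite dotRd_axis addr0 mulN1r mulrC.
  have P2 : trigpoly 1 rho^-1 (fun x : Rd R d => fejer N (tnth x i / rho)).
    have Pjk (j k : 'I_N) : trigpoly 1 rho^-1 (fun x : Rd R d =>
        cos ((j%:R - k%:R) * (tnth x i / rho / N%:R))).
      have jkN : `|j%:R - k%:R| <= N%:R :> R.
        have := ltn_ord j; have := ltn_ord k.
        rewrite -!(ltr_nat R) => kN jN.
        have : 0 <= j%:R :> R by [].
        have : 0 <= k%:R :> R by [].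
        by rewrite ler_norml => k0 j0; apply/andP; split; lra.
      have ckj : `|(j%:R - k%:R) / (rho * N%:R)| <= rho^-1.
        rewrite normrM normfV (gtr0_norm (mulr_gt0 rho0 NR0)).
        by rewrite ler_pdivrMr ?mulr_gt0// mulKf ?lt0r_neq0.
      have := trigpoly_cos 0 (axisP _ ckj).
      apply: trigpoly_eq => x; rewrite dotRd_axis addr0; congr cos.
      by field; rewrite !lt0r_neq0.
    have := trigpolyZ (N%:R ^- 2) (trigpoly_sum (index_enum 'I_N) (fun j =>
      trigpoly_sum (index_enum 'I_N) (Pjk j))).
    rewrite size_index_enum_ord ger0_norm ?invr_ge0 ?exprn_ge0//.
    rewrite -mulrnA -[1 *+ _]/(_%:R) natrM -expr2 mulVf ?expf_neq0 ?lt0r_neq0//.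
  have := trigpolyM ler01 P1 P2; rewrite mulr1.
  by rewrite (_ : rho^-1 + rho^-1 = 2 / rho)//; field; rewrite lt0r_neq0.
have := trigpoly_prod (index_enum 'I_d) (ler0n _ _) P.
by rewrite size_index_enum_ord.
Qed.

End fejer_kernel.

(** * Boxes in R^d *)

Section boxes.
Variables (R : realType) (d : nat).
Implicit Types (x y z : Rd R d) (rho L e : R) (N : nat).

Definition boxRd (I : set R) : set (Rd R d) := [set y | forall i, I (tnth y i)].

Lemma boxRdE I : boxRd I = \bigcap_(i in [set: 'I_d]) [set y | I (tnth y i)].
Proof. by apply/seteqP; split=> y /= h; [move=> i _|move=> i]; exact: h. Qed.

Lemma measurable_boxRd I : measurable (I : set (measurableTypeR R)) ->
  measurable (boxRd I).
Proof.
move=> mI; rewrite boxRdE; apply: fin_bigcap_measurable => // i _.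
by rewrite -[X in measurable X]setTI; exact: measurable_tnth.
Qed.

Lemma indic_boxRd I y : \1_(boxRd I) y = \prod_(i < d) \1_I (tnth y i) :> R.
Proof.
have [yI|yI] := pselect (boxRd I y).
  rewrite indicE mem_set// big1// => i _.
  by rewrite indicE mem_set//; exact: yI.
rewrite indicE memNset//; have /existsNP[i yi] := yI.
by rewrite (bigD1 i)//= indicE memNset// mul0r.
Qed.

Lemma lebRd_boxRd (a b : R) : a < b ->
  @lebRd R d (boxRd `[a, b]) = ((b - a) ^+ d)%:E.
Proof.
move=> ab; have mI : measurable (`[a, b]%classic : set (measurableTypeR R)).
  exact: measurable_itv.
have mB := measurable_boxRd mI.
have -> : @lebRd R d (boxRd `[a, b]) =
    (\int[@lebRd R d]_y (\1_(boxRd `[a, b]) y)%:E)%E.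
  by rewrite integral_indic// setIT.
under eq_integral do rewrite indic_boxRd.
rewrite (@integral_lebRd_prod R d (fun=> \1_(`[a, b]%classic)) (fun=> b - a))//.
- by rewrite prodr_const card_ord.
- by move=> _; rewrite integral_indic// setIT/= lebesgue_measure_itv/= lte_fin ab.
Qed.

(** With [rho = r / sqrt d] the box sits in the shell between radii [r / 2] and [r]; in particular
    it avoids the origin when [d] is positive. *)
Lemma normRd_boxRd rho y : 0 < rho -> boxRd `[rho / 2, rho] y ->
  rho * Num.sqrt d%:R / 2 <= normRd y <= rho * Num.sqrt d%:R.
Proof.
move=> rho0 By.
have yi i : rho / 2 <= tnth y i <= rho by have := By i; rewrite /= in_itv.
have r0 : 0 <= rho * Num.sqrt d%:R by rewrite mulr_ge0 ?sqrtr_ge0 ?ltW.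
apply/andP; split; rewrite -(@ler_sqr R) ?nnegrE ?normRd_ge0 ?divr_ge0//.
  rewrite normRd_sqr !exprMn sqr_sqrtr ?ler0n// mulrAC mulr_natr -[X in _ *+ X]card_ord.
  rewrite -sumr_const; apply: ler_sum => i _.
  have /andP[y1 _] := yi i; rewrite -exprMn.
  rewrite ler_sqr ?nnegrE ?divr_ge0 ?(ltW rho0)//; apply: le_trans y1.
  by rewrite divr_ge0// ltW.
rewrite normRd_sqr !exprMn sqr_sqrtr ?ler0n// mulr_natr -[X in _ *+ X]card_ord.
rewrite -sumr_const; apply: ler_sum => i _.
have /andP[y1 y2] := yi i; rewrite ler_sqr ?nnegrE ?(ltW rho0)//.
by apply: le_trans y1; rewrite divr_ge0// ltW.
Qed.

(** The window is one full period in every coordinate, so the integral factors and its bound is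
    uniform in the centre [z]. The map [s] stands for [addRd z] when [e = 1] and for [subRd z] when
    [e = -1]. *)
Lemma integral_bumpRd_window N rho e z (s : Rd R d -> Rd R d) :
  (0 < N)%N -> 0 < rho -> `|e| = 1 ->
  (forall y i, tnth (s y) i = tnth z i + e * tnth y i) ->
  (\int[@lebRd R d]_(y in boxRd `[(- (pi * N%:R * rho))%R, (pi * N%:R * rho)%R])
     (bumpRd N rho (s y))%:E <= ((4 * pi * rho) ^+ d)%:E)%E.
Proof.
move=> N0 rho0 e1 sE; set I := `[_, _]%classic.
have mI : measurable (I : set (measurableTypeR R)) by exact: measurable_itv.
have hm i := cid2 (integral_bump_window (tnth z i) N0 rho0 e1).
pose h (i : 'I_d) (y : R) := \1_I y * fbump N ((tnth z i + e * y) / rho) : R.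
rewrite -integral_indicM.
have hE y : \1_(boxRd I) y * bumpRd N rho (s y) = \prod_(i < d) h i (tnth y i).
  rewrite indic_boxRd -big_split/=; apply: eq_bigr => i _.
  by rewrite sE.
under eq_integral do rewrite hE.
rewrite (@integral_lebRd_prod R d h (fun i => s2val (hm i))); last 3 first.
- move=> i; apply: measurable_funM; first exact: measurable_indic.
  apply: measurableT_comp; first exact: measurable_bump.
  by apply: measurable_funM => //; apply: measurable_funD => //; exact: measurable_funM.
- by move=> i a; rewrite mulr_ge0// bump_ge0.
- by move=> i; case: (hm i).
rewrite lee_fin -[X in _ ^+ X]card_ord -prodr_const; apply: ler_prod => i _.
by case: (hm i).
Qed.

Lemma bumpRd_boxRd N rho y : (0 < N)%N -> 0 < rho -> boxRd `[rho / 2, rho] y ->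
  bump_min R ^+ d <= bumpRd N rho y.
Proof.
move=> N0 rho0 By; rewrite -[X in _ ^+ X]card_ord -prodr_const.
apply: ler_prod => i _; rewrite ltW ?bump_min_gt0//= bump_ge//.
have := By i; rewrite /= in_itv/= => /andP[y1 y2].
by rewrite ler_pdivlMr// ler_pdivrMr// mul1r mulrC y1 y2.
Qed.

Lemma boxRd_cover c y : 0 < c ->
  \forall n \near \oo, boxRd `[- (c * n.+1%:R), c * n.+1%:R] y.
Proof.
move=> c0; near=> n => i; rewrite /= in_itv/= -ler_norml.
apply: le_trans (tnth_normRd y i) _; rewrite -ler_pdivrMl// ltW//.
apply: (@lt_trans _ _ n%:R); last by rewrite ltr_nat.
by near: n; exact: nbhs_infty_gtr.
Unshelve. all: by end_near. Qed.

(** Dominated convergence: the boxes exhaust the space, so the indicators of their complements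
    vanish eventually at each point. With [c = pi * rho] these boxes are the period windows for
    [N = n.+1]. *)
Lemma integral_outside_boxRd c (D : set (Rd R d)) (nu : Rd R d -> R) eps :
  0 < c -> 0 < eps -> measurable D ->
  measurable_fun [set: Rd R d] nu -> (forall y, 0 <= nu y) ->
  (@lebRd R d).-integrable D (EFin \o nu) ->
  exists n, (\int[@lebRd R d]_(y in D)
    (\1_(~` boxRd `[- (c * n.+1%:R), c * n.+1%:R]) y * nu y)%:E <= eps%:E)%E.
Proof.
move=> c0 eps0 mD mnu nu0 inu.
pose B n : set (Rd R d) := ~` boxRd `[- (c * n.+1%:R), c * n.+1%:R].
have mB n : measurable (B n).
  by apply: measurableC; apply: measurable_boxRd; exact: measurable_itv.
have [] := @dominated_convergence _ _ _ (@lebRd R d) D mD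
  (fun n y => (\1_(B n) y * nu y)%:E) (cst 0%E) (EFin \o nu).
- move=> n; apply/measurable_EFinP; apply: measurable_funM.
    exact/measurable_indic.
  exact: measurable_funTS.
- exact: measurable_cst.
- apply: aeW => y _; apply: cvg_near_cst.
  have := boxRd_cover y c0; apply: filterS => n yn.
  by rewrite indicE memNset ?mul0r//; exact.
- by [].
- apply: aeW => y n _; rewrite lee_fin normrM (ger0_norm (nu0 y)).
  by rewrite ler_piMl// indicE; case: (_ \in _); rewrite ?normr1 ?normr0.
move=> _ _; rewrite integral_cst//= mul0e => /fine_cvgP[].
move=> fnum /cvgrPdist_le /(_ _ eps0).
move=> /(filterI fnum) /filter_ex [n [nfin]]; rewrite sub0r normrN => neps.
exists n; by rewrite -(fineK nfin) lee_fin (le_trans _ neps)// ler_norm.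
Qed.

End boxes.

(** * Characteristic function of the process *)

Section semigroup.
Variable R : realType.

(** Being the square of [phi (t / 2)], [phi t] is non-negative, so the bound by 1 makes [phi]
    non-increasing. Trapping large multiples of [t] between consecutive integers then determines
    [ln (phi t)]. *)
Lemma multiplicative_semigroup_expR (phi : R -> R) (psi : R) :
  (forall s t, 0 < s -> 0 < t -> phi (s + t) = phi s * phi t) ->
  (forall t, 0 < t -> phi t <= 1) -> phi 1 = expR (- psi) ->
  forall t, 0 < t -> phi t = expR (- (t * psi)).
Proof.
move=> phiD phi_le1 phi1.
have phi_ge0 t : 0 < t -> 0 <= phi t.
  by move=> t0; rewrite (splitr t) phiD ?divr_gt0// -expr2 sqr_ge0.
have phi_anti s t : 0 < s -> s <= t -> phi t <= phi s.
  move=> s0; rewrite le_eqVlt => /predU1P[->//|st].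
  by rewrite -(subrK s t) addrC phiD ?subr_gt0// ler_piMr ?phi_ge0 ?phi_le1 ?subr_gt0.
have phiMn n t : 0 < t -> phi (n.+1%:R * t) = phi t ^+ n.+1.
  move=> t0; elim: n => [|n IHn]; first by rewrite mul1r expr1.
  by rewrite -natr1 mulrDl mul1r phiD ?mulr_gt0// IHn [RHS]exprSr.
have psi0 : 0 <= psi.
  by have := phi_le1 _ ltr01; rewrite phi1 expR_le1 oppr_le0.
have phin n : phi n.+1%:R = expR (- (n.+1%:R * psi)).
  by rewrite -[n.+1%:R]mulr1 phiMn// phi1 -expRM_natl mulrN mulr1.
move=> t t0.
have truncP (s : R) : 0 <= s -> (Num.truncn s)%:R <= s < (Num.truncn s).+1%:R.
  exact: Num.Theory.truncn_itv.
(* Positivity comes from comparison with the next integer time, where [phi] is an exponential. *)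
have phit0 : 0 < phi t.
  have /andP[_ /ltW tn] := truncP _ (ltW t0).
  by apply: lt_le_trans (phi_anti _ _ t0 tn); rewrite phin expR_gt0.
rewrite -[LHS]lnK ?posrE//; congr expR.
apply/eqP; rewrite -subr_eq0 opprK; apply/eqP; set b := ln _ + _.
apply/eqP; rewrite -normr_le0; apply/ler_addgt0Pl => e e0; rewrite addr0.
(* This choice gives [psi <= n.+1%:R * e], so bounding [n.+1%:R * |b|] by [psi] suffices. *)
pose n := Num.truncn (psi / e).
(* Both [ln (phi s)] and [- (s * psi)] lie between [- (m.+1%:R * psi)] and [- (m%:R * psi)], an
   interval of length [psi]. *)
have bn : n.+1%:R * `|b| <= psi.
  pose s := n.+1%:R * t; have s0 : 0 < s by rewrite mulr_gt0.
  have /andP[ms sm] := truncP _ (ltW s0); set m := Num.truncn s in ms sm.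
  have lnphi : ln (phi s) = n.+1%:R * ln (phi t).
    by rewrite phiMn// lnXn// mulr_natl.
  have lb : - (m.+1%:R * psi) <= ln (phi s).
    rewrite -[leLHS]expRK ler_ln ?posrE ?expR_gt0//; last by rewrite phiMn// exprn_gt0.
    by rewrite -phin phi_anti// ltW.
  have ub : ln (phi s) <= - (m%:R * psi).
    (* The formula at integer times starts at 1; for [m = 0] the upper bound is [phi s <= 1]. *)
    case: (m) ms => [_|k ks]; first by rewrite mul0r oppr0 ln_le0// phi_le1.
    rewrite -[leRHS]expRK ler_ln ?posrE ?expR_gt0//; last by rewrite phiMn// exprn_gt0.
    by rewrite -phin phi_anti.
  rewrite -[n.+1%:R]ger0_norm// -normrM /b mulrDr -lnphi mulrA -/s.
  rewrite ler_norml; move: lb ub; rewrite -natr1 in sm *.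
  have := ler_wpM2r psi0 ms; have := ler_wpM2r psi0 (ltW sm).
  by rewrite !mulrDl mul1r => h1 h2 h3 h4; apply/andP; split; lra.
have /andP[_ /ltW] := truncP _ (divr_ge0 psi0 (ltW e0)); rewrite -/n => ne.
rewrite -(ler_pM2l (ltr0Sn _ n)); apply: le_trans bn _.
by move: ne; rewrite ler_pdivrMr.
Qed.

End semigroup.

(** * Integrals of bounded functions, equality in law and independence *)

Section laws.
Context (R : realType) d0 (T : measurableType d0) (P : probability T R).

Lemma bounded_integrable (f : T -> R) (M : R) : measurable_fun [set: T] f ->
  (forall w, `|f w| <= M) -> P.-integrable setT (EFin \o f).
Proof.
move=> mf fM; apply: (@le_integrable _ _ _ _ _ _ _ (EFin \o cst M)) => //.
- exact/measurable_EFinP.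
- by move=> w _; rewrite lee_fin (le_trans (fM w))// ler_norm.
- exact: finite_measure_integrable_cst.
Qed.

End laws.

Section laws_of_random_elements.
Context (R : realType) d0 (T : measurableType d0) (P : probability T R).
Context d1 (T1 : measurableType d1).

Lemma eq_law_integral (U V : T -> T1) (h : T1 -> R) (M : R) :
  measurable_fun setT U -> measurable_fun setT V -> measurable_fun setT h ->
  (forall x, `|h x| <= M) ->
  (forall A, measurable A -> P (U @^-1` A) = P (V @^-1` A)) ->
  (\int[P]_w (h (U w))%:E = \int[P]_w (h (V w))%:E)%E.
Proof.
move=> mU mV mh hM UV.
pose U' : {mfun T >-> T1} := HB.pack U (isMeasurableFun.Build _ _ _ _ U mU).
pose V' : {mfun T >-> T1} := HB.pack V (isMeasurableFun.Build _ _ _ _ V mV).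
have mhE : measurable_fun setT (EFin \o h) by exact/measurable_EFinP.
transitivity (\int[distribution P U']_x (h x)%:E)%E.
  rewrite integral_distribution//; apply: (@bounded_integrable _ _ _ _ (h \o U) M).
    exact: measurableT_comp.
  by move=> w; exact: hM.
transitivity (\int[distribution P V']_x (h x)%:E)%E.
  by apply: eq_measure_integral => A mA _; exact: UV.
rewrite integral_distribution//; apply: (@bounded_integrable _ _ _ _ (h \o V) M).
  exact: measurableT_comp.
by move=> w; exact: hM.
Qed.

Context d2 (T2 : measurableType d2).

(** Independence says that the joint law agrees with the product of the laws on rectangles, hence
    everywhere by uniqueness of the product measure; Fubini then separates the factors. *)
Lemma independent_integralM (U : T -> T1) (V : T -> T2) (h : T1 -> R) (k : T2 -> R) :
  measurable_fun setT U -> measurable_fun setT V ->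
  measurable_fun setT h -> measurable_fun setT k ->
  (forall x, `|h x| <= 1) -> (forall y, `|k y| <= 1) ->
  (forall A B, measurable A -> measurable B ->
    P (U @^-1` A `&` V @^-1` B) = (P (U @^-1` A) * P (V @^-1` B))%E) ->
  (\int[P]_w (h (U w) * k (V w))%:E =
   (\int[P]_w (h (U w))%:E) * \int[P]_w (k (V w))%:E)%E.
Proof.
move=> mU mV mh mk h1 k1 ind.
pose U' : {mfun T >-> T1} := HB.pack U (isMeasurableFun.Build _ _ _ _ U mU).
pose V' : {mfun T >-> T2} := HB.pack V (isMeasurableFun.Build _ _ _ _ V mV).
have mW : measurable_fun setT (fun w => (U w, V w)) by exact: measurable_fun_pair.
pose W : {mfun T >-> (T1 * T2)%type} :=
  HB.pack (fun w => (U w, V w)) (isMeasurableFun.Build _ _ _ _ _ mW).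
pose g (z : T1 * T2) := h z.1 * k z.2.
have mg : measurable_fun setT g.
  by apply: measurable_funM; apply: measurableT_comp.
have mgE : measurable_fun setT (EFin \o g) by exact/measurable_EFinP.
have g1 z : `|g z| <= 1 by rewrite normrM mulr_ile1.
pose m1 := distribution P U'; pose m2 := distribution P V'.
have WE X : measurable X -> (m1 \x m2)%E X = distribution P W X.
  by move=> mX; apply: (product_measure_unique (m' := distribution P W)).
have gint : (m1 \x m2)%E.-integrable setT (EFin \o g).
  apply/integrableP; split=> //.
  rewrite (eq_measure_integral (distribution P W)); last by move=> A mA _; exact: WE.
  by have /integrableP[] := bounded_integrable (distribution P W) mg g1.
transitivity (\int[distribution P W]_z (g z)%:E)%E.
  rewrite integral_distribution//.
  apply: (@bounded_integrable _ _ _ _ (g \o (fun w => (U w, V w))) 1).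
    exact: (measurableT_comp mg mW).
  by move=> w; exact: g1.
transitivity (\int[(m1 \x m2)%E]_z (g z)%:E)%E.
  by apply: eq_measure_integral => A mA _; exact/esym/WE.
rewrite -(integral12_prod_meas1 gint)/=.
have k_int : m2.-integrable setT (EFin \o k) by exact: bounded_integrable k1.
have h_int : m1.-integrable setT (EFin \o h) by exact: bounded_integrable h1.
transitivity (\int[m1]_x ((h x)%:E * \int[m2]_y (k y)%:E))%E.
  by apply: eq_integral => x _; rewrite -integralZl.
rewrite -(fineK (integrable_fin_num measurableT k_int)).
rewrite integralZr//; congr (_ * _)%E.
  rewrite integral_distribution//; first exact/measurable_EFinP.
  by apply: (@bounded_integrable _ _ _ _ (h \o U) 1) => [|w /=];
    [exact: (measurableT_comp mh mU)|exact: h1].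
rewrite fineK; last exact: integrable_fin_num.
rewrite integral_distribution//; first exact/measurable_EFinP.
by apply: (@bounded_integrable _ _ _ _ (k \o V) 1) => [|w /=];
    [exact: (measurableT_comp mk mV)|exact: k1].
Qed.

End laws_of_random_elements.

(** * Symmetry and the semigroup property of the characteristic function *)

Section characteristic_function.
Context (R : realType) (d : nat) d0 (T : measurableType d0) (P : probability T R).
Variables (X : R -> T -> Rd R d) (p : R -> Rd R d -> R).
Hypothesis levyX : levy_process P X.
Hypothesis densX : radial_density_of P X p.
Implicit Types (x y xi : Rd R d) (s t : R).

Lemma oppRd0 : oppRd (zeroRd R d) = zeroRd R d.
Proof. by apply: eq_from_tnth => i; rewrite !tnth_mktuple oppr0. Qed.

Lemma oppRd_eq0 x : (oppRd x == zeroRd R d) = (x == zeroRd R d).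
Proof.
apply/eqP/eqP => [x0|->]; last exact: oppRd0.
by rewrite -[x]oppRdK x0 oppRd0.
Qed.

Lemma normRdN x : normRd (oppRd x) = normRd x.
Proof.
by congr Num.sqrt; apply: eq_bigr => i _; rewrite tnth_mktuple sqrrN.
Qed.

Lemma dotRdN xi x : dotRd xi (oppRd x) = - dotRd xi x.
Proof. by rewrite /dotRd -sumrN; apply: eq_bigr => i _; rewrite tnth_mktuple mulrN. Qed.

Lemma measurable_zeroRd : measurable [set zeroRd R d].
Proof.
rewrite (_ : [set _] = boxRd [set 0]).
  apply: measurable_boxRd; exact: measurable_set1.
apply/seteqP; split=> [y -> i|y y0] /=; first by rewrite tnth_mktuple.
by apply: eq_from_tnth => i; rewrite tnth_mktuple; exact: y0.
Qed.

(** The density describes the law only off the origin, so a possible atom there is split off;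
    reflection fixes it. On the rest, a radial density and reflection invariance of [lebRd] give the
    symmetry. *)
Lemma symmetric_law t A : 0 < t -> measurable A ->
  P (X t @^-1` A) = P ((@oppRd R d \o X t) @^-1` A).
Proof.
move=> t0 mA; have [mp p0 [g [_ pE]] pX] := densX t0.
have [_ /(_ t (ltW t0)) mX _ _ _] := levyX.
have mN := @measurable_oppRd R d.
have mXA B : measurable B -> measurable (X t @^-1` B).
  by move=> mB; rewrite -[X in measurable X]setTI; exact: mX.
have split0 B : measurable B -> P (X t @^-1` B) =
    (P [set w | (B `\ zeroRd R d) (X t w)] + P (X t @^-1` (B `&` [set zeroRd R d])))%E.
  move=> mB; rewrite -measureU.
  - congr (P _); apply/seteqP; split=> w /=.
      by move=> Bw; have [w0|w0] := pselect (X t w = zeroRd R d); [right|left].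
    by case=> -[].
  - by apply: mXA; apply: measurableD => //; exact: measurable_zeroRd.
  - by apply: mXA; apply: measurableI => //; exact: measurable_zeroRd.
  - by apply/seteqP; split=> w //= -[[_ ?] []].
have mNA : measurable (@oppRd R d @^-1` A).
  by rewrite -[X in measurable X]setTI; exact: mN.
rewrite split0// [RHS](split0 (@oppRd R d @^-1` A))//; congr (_ + P _)%E; last first.
  by apply/seteqP; split=> w /= -[Aw w0]; move: Aw; rewrite w0 oppRd0.
rewrite !pX//.
have mA0 : measurable (A `\ zeroRd R d).
  by apply: measurableD => //; exact: measurable_zeroRd.
rewrite -[LHS]integral_indicM -[RHS]integral_indicM -[LHS]integral_lebRdN; last 2 first.
- by apply/measurable_EFinP; apply: measurable_funM => //; exact: measurable_indic.
- by move=> x; rewrite lee_fin mulr_ge0.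
apply: eq_integral => x _; congr EFin.
have [->|x0] := eqVneq x (zeroRd R d).
  by rewrite oppRd0 !indicE !memNset ?mul0r// => -[_ /(_ erefl)].
rewrite !pE ?oppRd_eq0// normRdN; congr (_ * _); rewrite !indicE.
congr (nat_of_bool _)%:R; apply/idP/idP; rewrite !inE => -[Ax _]; split=> //.
  exact/eqP.
by apply/eqP; rewrite oppRd_eq0.
Qed.

Lemma measurable_sin_dotRd xi : measurable_fun [set: Rd R d] (fun x => sin (dotRd xi x)).
Proof.
have msin : measurable_fun [set: R] (@sin R).
  by apply: continuous_measurable_fun; exact: continuous_sin.
exact: measurableT_comp msin (measurable_dotRd xi).
Qed.

Lemma measurable_cos_dotRd0 xi : measurable_fun [set: Rd R d] (fun x => cos (dotRd xi x)).
Proof. exact: measurableT_comp (@measurable_cosR R) (measurable_dotRd xi). Qed.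

Let mX t : 0 <= t -> measurable_fun setT (X t).
Proof. by case: levyX => _ + _ _ _; apply. Qed.

(** By symmetry of the law this integral equals its own negative, and it is finite. *)
Lemma integral_sin_levy xi t : 0 < t ->
  (\int[P]_w (sin (dotRd xi (X t w)))%:E = 0)%E.
Proof.
move=> t0; have mXt := mX (ltW t0); have msin := measurable_sin_dotRd xi.
have mN := measurableT_comp (@measurable_oppRd R d) mXt.
have isin : P.-integrable setT (EFin \o (fun w => sin (dotRd xi (X t w)))).
  apply: (@bounded_integrable _ _ _ _ _ 1) => [|w]; last exact: sin_max.
  exact: measurableT_comp msin mXt.
have := eq_law_integral mXt mN msin (fun x => sin_max _) (fun A => symmetric_law t0).
under [X in _ = X -> _]eq_integral do rewrite /= dotRdN sinN EFinN.
rewrite integralN; last first.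
  exact/integrable_add_def.
have /fin_numP := integrable_fin_num measurableT isin.
move: (\int[P]_w (sin (dotRd xi (X t w)))%:E)%E => [r||] [//_ _] [] rN.
by congr EFin; lra.
Qed.

(** For [t > 0] this is the whole characteristic function, its imaginary part being zero by
    [integral_sin_levy]. *)
Definition cf xi t : R := fine (\int[P]_w (cos (dotRd xi (X t w)))%:E)%E.

Lemma cfE xi t : 0 <= t ->
  (\int[P]_w (cos (dotRd xi (X t w)))%:E = (cf xi t)%:E)%E.
Proof.
move=> t0; rewrite fineK//; apply: integrable_fin_num => //.
apply: (@bounded_integrable _ _ _ _ _ 1) => [|w]; last exact: cos_max.
exact: measurableT_comp (measurable_cos_dotRd0 xi) (mX t0).
Qed.

Lemma cf_le1 xi t : 0 <= t -> cf xi t <= 1.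
Proof.
move=> t0; rewrite -lee_fin -cfE//.
apply: (@le_trans _ _ (\int[P]_w (cst 1%E w))%E); last first.
  by rewrite integral_cst//= probability_setT mule1.
apply: le_integral => //.
- apply: (@bounded_integrable _ _ _ _ _ 1) => [|w]; last exact: cos_max.
  exact: measurableT_comp (measurable_cos_dotRd0 xi) (mX t0).
- exact: finite_measure_integrable_cst.
- by move=> w _; rewrite lee_fin cos_le1.
Qed.

(** Write [X (s + t)] as [X s] plus the increment [V], which is independent of [X s] and has the law
    of [X t]. In the cosine addition formula the sine product has zero expectation. *)
Lemma cfD xi s t : 0 < s -> 0 < t -> cf xi (s + t) = cf xi s * cf xi t.
Proof.
move=> s0 t0; have st0 : 0 < s + t by rewrite addr_gt0.
have [X0 _ indX statX _] := levyX.
have mXs := mX (ltW s0); have mXt := mX (ltW t0); have mXst := mX (ltW st0).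
pose V w := subRd (X (s + t) w) (X s w).
have mV : measurable_fun setT V.
  apply/measurable_fun_tnthP => i.
  rewrite (_ : _ \o _ = fun w => tnth (X (s + t) w) i - tnth (X s w) i).
    apply: measurable_funB.
      exact: measurableT_comp (measurable_tnth i) mXst.
    exact: measurableT_comp (measurable_tnth i) mXs.
  by apply/funext => w /=; rewrite tnth_mktuple.
have sub0 x : subRd x (zeroRd R d) = x.
  by apply: eq_from_tnth => i; rewrite !tnth_mktuple subr0.
have lawV A : measurable A -> P (V @^-1` A) = P (X t @^-1` A).
  move=> mA; have := statX s (s + t) A (ltW s0); rewrite lerDl ltW// addrAC subrr add0r.
  exact.
have ind A B : measurable A -> measurable B ->
    P (X s @^-1` A `&` V @^-1` B) = (P (X s @^-1` A) * P (V @^-1` B))%E.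
  move=> mA mB.
  (* The times are 0, [s], [s + t], constant afterwards. As the process starts at zero, the first of
     the two increments is [X s] itself. *)
  pose u k := if k is k'.+1 then (if k' is _.+1 then s + t else s) else 0.
  pose C k := if k is _.+1 then B else A.
  have u_nd k : u k <= u k.+1.
    by case: k => [|[|k]] //=; [exact: ltW|rewrite lerDl ltW].
  have mC k : measurable (C k) by case: k.
  have := indX 2%N u C (lexx _) u_nd mC.
  rewrite big_ord_recl big_ord1/=.
  have XE w : subRd (X s w) (X 0 w) = X s w by rewrite X0 sub0.
  have -> : [set w | A (subRd (X s w) (X 0 w))] = X s @^-1` A.
    by apply/seteqP; split=> w /=; rewrite XE.
  move=> <-; congr (P _); apply/seteqP; split=> w /=.
    by move=> [Aw Bw] [|[|k]]//= _; rewrite XE.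
  by move=> H; split; [have := H 0%N isT; rewrite /= XE|exact: (H 1%N isT)].
have mc := measurable_cos_dotRd0 xi; have ms := measurable_sin_dotRd xi.
apply: EFin_inj; rewrite EFinM -!cfE ?ltW//.
transitivity (\int[P]_w ((cos (dotRd xi (X s w)) * cos (dotRd xi (V w)))%:E -
    (sin (dotRd xi (X s w)) * sin (dotRd xi (V w)))%:E))%E.
  apply: eq_integral => w _; rewrite -EFinB -cosD /V dotRdBr.
  by congr (cos _)%:E; ring.
rewrite integralB//=; last 2 first.
- apply: (@bounded_integrable _ _ _ _
    (fun w => cos (dotRd xi (X s w)) * cos (dotRd xi (V w))) 1) => [|w].
    apply: measurable_funM; first exact: measurableT_comp mc mXs.
    exact: measurableT_comp mc mV.
  by rewrite normrM mulr_ile1// cos_max.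
- apply: (@bounded_integrable _ _ _ _
    (fun w => sin (dotRd xi (X s w)) * sin (dotRd xi (V w))) 1) => [|w].
    apply: measurable_funM; first exact: measurableT_comp ms mXs.
    exact: measurableT_comp ms mV.
  by rewrite normrM mulr_ile1// sin_max.
rewrite (independent_integralM mXs mV mc mc)//; try by move=> x; exact: cos_max.
rewrite (independent_integralM mXs mV ms ms)//; try by move=> x; exact: sin_max.
rewrite integral_sin_levy// mul0e sube0; congr (_ * _)%E.
by apply: (eq_law_integral mV mXt mc) => // x; exact: cos_max.
Qed.

Lemma cf_expR psi xi t : cf xi 1 = expR (- psi) -> 0 < t ->
  cf xi t = expR (- (t * psi)).
Proof.
move=> cf1; apply: (multiplicative_semigroup_expR _ _ cf1) => [s u|u].
  exact: cfD.
by move=> /ltW; exact: cf_le1.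
Qed.

Lemma integral_cos_levy psi xi th t : cf xi 1 = expR (- psi) -> 0 < t ->
  (\int[P]_w (cos (dotRd xi (X t w) + th))%:E =
   (cos th * expR (- (t * psi)))%:E)%E.
Proof.
move=> cf1 t0; have mXt := mX (ltW t0).
have mc := measurable_cos_dotRd0 xi; have ms := measurable_sin_dotRd xi.
have icos : P.-integrable setT (EFin \o (fun w => cos (dotRd xi (X t w)))).
  apply: (@bounded_integrable _ _ _ _ _ 1) => [|w]; last exact: cos_max.
  exact: measurableT_comp mc mXt.
have isin : P.-integrable setT (EFin \o (fun w => sin (dotRd xi (X t w)))).
  apply: (@bounded_integrable _ _ _ _ _ 1) => [|w]; last exact: sin_max.
  exact: measurableT_comp ms mXt.
transitivity (\int[P]_w ((cos th)%:E * (cos (dotRd xi (X t w)))%:E -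
    (sin th)%:E * (sin (dotRd xi (X t w)))%:E))%E.
  apply: eq_integral => w _; rewrite -!EFinM -EFinB cosD.
  by rewrite mulrC [sin th * _]mulrC.
rewrite integralB//=; [|exact: integrableZl|exact: integrableZl].
rewrite !integralZl// integral_sin_levy// mule0 sube0 cfE ?ltW// -EFinM.
by rewrite (cf_expR cf1).
Qed.

End characteristic_function.

(** * Generator and Dynkin's formula *)

Section levy_density.
Context (R : realType) (d : nat).
Variable nu : Rd R d -> R.
Hypothesis nuP : unimodal_levy_density nu.
Implicit Types (x y z xi : Rd R d) (r : R).

Let mnu : measurable_fun [set: Rd R d] nu. Proof. by case: nuP. Qed.
Let nu0 y : 0 <= nu y. Proof. by case: nuP. Qed.

Lemma integrable_levy_density : (@lebRd R d).-integrable setT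
  (fun y => (Num.min 1 (normRd y ^+ 2) * nu y)%:E).
Proof.
have [_ _ _ ioo] := nuP; apply/integrableP; split.
  apply/measurable_EFinP; apply: measurable_funM => //.
  apply: measurable_minr => //; apply: measurable_funX; exact: measurable_normRd.
rewrite (eq_integral (fun y => (Num.min 1 (normRd y ^+ 2) * nu y)%:E))// => y _.
by rewrite gee0_abs// lee_fin mulr_ge0// le_min ler01 sqr_ge0.
Qed.

Lemma dominated_integrable (D : set (Rd R d)) (h : Rd R d -> R) (c : R) :
  measurable D -> measurable_fun [set: Rd R d] h ->
  (forall y, D y -> `|h y| <= c * Num.min 1 (normRd y ^+ 2)) ->
  (@lebRd R d).-integrable D (fun y => (h y * nu y)%:E).
Proof.
move=> mD mh hc.
apply: (@le_integrable _ _ _ _ D mD _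
    (fun y => (c%:E * (Num.min 1 (normRd y ^+ 2) * nu y)%:E)%E)).
- by apply/measurable_EFinP; apply: measurable_funTS; exact: measurable_funM.
- move=> y Dy; rewrite -EFinM lee_fin [leLHS]normrM [X in _ * X]ger0_norm//.
  rewrite mulrA; apply: le_trans (ler_norm _); exact: ler_wpM2r (hc y Dy).
- apply: integrableZl => //.
  by apply: integrableS integrable_levy_density.
Qed.

Lemma integrable_one_minus_cos xi : (@lebRd R d).-integrable setT
  (fun y => ((1 - cos (dotRd xi y)) * nu y)%:E).
Proof.
pose S := \sum_(i < d) `|tnth xi i|.
(* The 2 bounds [1 - cos] where the minimum is 1, and [S ^+ 2] covers the quadratic bound near the
   origin. *)
apply: (@dominated_integrable _ _ (2 + S ^+ 2)) => //.
  by apply: measurable_funB => //; exact: measurable_cos_dotRd0.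
move=> y _; rewrite ger0_norm ?one_minus_cos_ge0//.
have S2 := sqr_ge0 S; have cN := cos_geN1 (dotRd xi y).
rewrite minEle; case: ifPn => _; first by lra.
apply: le_trans (one_minus_cos_le _) _.
have : dotRd xi y ^+ 2 <= (S * normRd y) ^+ 2.
  rewrite -(real_normK (num_real (dotRd _ _))) ler_sqr ?nnegrE ?normr_dotRd//.
  by rewrite mulr_ge0 ?normRd_ge0 ?sumr_ge0.
have := sqr_ge0 (normRd y); rewrite exprMn mulrDl => n0.
have : 0 <= S ^+ 2 * normRd y ^+ 2 by rewrite mulr_ge0.
by move=> h1 h2; lra.
Qed.

(** The integral is finite, so the [fine] in [levy_exponent] does not fall back on its default
    value. *)
Lemma levy_exponentE xi :
  (\int[@lebRd R d]_y ((1 - cos (dotRd xi y)) * nu y)%:E =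
   (levy_exponent nu xi)%:E)%E.
Proof. by rewrite fineK//; exact: integrable_fin_num (integrable_one_minus_cos xi). Qed.

Lemma measurable_ballRd r : measurable [set y : Rd R d | normRd y <= r].
Proof.
rewrite (_ : [set _ | _] = setT `&` @normRd R d @^-1` `]-oo, r]).
  by apply: measurable_normRd => //; exact: measurable_itv.
by rewrite setTI; apply/seteqP; split=> y /=; rewrite in_itv.
Qed.

Lemma integrable_levy_tail r : 0 < r ->
  (@lebRd R d).-integrable (~` [set y | normRd y <= r]) (EFin \o nu).
Proof.
move=> r0; have -> : EFin \o nu = (fun y => (1 * nu y)%:E).
  by apply/funext => y /=; rewrite mul1r.
(* Off the ball, 1 is at most [r ^- 2 * normRd y ^+ 2]; the summand 1 handles the points where the
   minimum is 1. *)
apply: (@dominated_integrable _ (cst 1) (1 + r ^- 2)) => //.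
  by apply: measurableC; exact: measurable_ballRd.
move=> y /= /negP; rewrite -ltNge => ry; rewrite normr1.
have r2 : 0 < r ^- 2 by rewrite invr_gt0 exprn_gt0.
rewrite minEle; case: ifPn => _; first by lra.
rewrite mulrDl mul1r.
have : 1 <= r ^- 2 * normRd y ^+ 2.
  rewrite ler_pdivlMl ?exprn_gt0// mulr1 ler_sqr ?nnegrE ?normRd_ge0 ?ltW//.
by have := sqr_ge0 (normRd y); lra.
Qed.

(** The generator as a Fourier multiplier: a cosine of frequency [xi] is multiplied by
    [- levy_exponent nu xi]. *)
Definition generator (s : seq (R * Rd R d * R)) z : R :=
  \sum_(j <- s) - (j.1.1 * levy_exponent nu j.1.2) * cos (dotRd j.1.2 z + j.2).

(** The multiplier form suits differentiation in time, the integral form suits estimates by jump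
    size; this identity joins them. *)
Lemma generatorE s z :
  (\int[@lebRd R d]_y (symdiff (trig_eval s) z y * nu y)%:E =
   (generator s z)%:E)%E.
Proof.
pose c (j : R * Rd R d * R) := - (j.1.1 * cos (dotRd j.1.2 z + j.2)).
transitivity (\int[@lebRd R d]_y \sum_(j <- s)
    ((c j)%:E * ((1 - cos (dotRd j.1.2 y)) * nu y)%:E))%E.
  apply: eq_integral => y _; rewrite symdiff_trig_eval mulr_suml -sumEFin.
  by apply: eq_bigr => j _; rewrite -EFinM mulrA.
rewrite integral_sum//; last first.
  by move=> j; apply: integrableZl => //; exact: integrable_one_minus_cos.
rewrite /generator -sumEFin; apply: eq_bigr => j _.
rewrite integralZl//; last exact: integrable_one_minus_cos.
by rewrite levy_exponentE -EFinM /c; congr EFin; ring.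
Qed.

End levy_density.

Section dynkin.
Context (R : realType) (d : nat) d0 (T : measurableType d0) (P : probability T R).
Variables (X : R -> T -> Rd R d) (nu : Rd R d -> R) (p : R -> Rd R d -> R).
Hypothesis levyX : pure_jump_levy_process P X nu.
Hypothesis densX : radial_density_of P X p.

Lemma integral_trig_levy (s : seq (R * Rd R d * R)) (b : R * Rd R d * R -> R) t :
  0 < t ->
  (\int[P]_w (\sum_(j <- s) b j * cos (dotRd j.1.2 (X t w) + j.2))%:E =
   (\sum_(j <- s) b j * (cos j.2 * expR (- (t * levy_exponent nu j.1.2))))%:E)%E.
Proof.
move=> t0; have [levy cfX] := levyX.
have mXt : measurable_fun setT (X t) by case: levy => _ + _ _ _; apply; exact: ltW.
have icos j : P.-integrable setT (EFin \o (fun w => cos (dotRd j.1.2 (X t w) + j.2))).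
  move: j => [[a xi] th]/=.
  apply: (@bounded_integrable _ _ _ _ _ 1) => [|w]; last exact: cos_max.
  exact: measurableT_comp (measurable_cos_dotRd xi th) mXt.
transitivity (\int[P]_w \sum_(j <- s)
    ((b j)%:E * (cos (dotRd j.1.2 (X t w) + j.2))%:E))%E.
  by apply: eq_integral => w _; rewrite -sumEFin; apply: eq_bigr => j _; rewrite EFinM.
rewrite integral_sum//; last by move=> j; apply: integrableZl => //; exact: icos.
rewrite -sumEFin; apply: eq_bigr => j _; rewrite integralZl//; last exact: icos.
rewrite (@integral_cos_levy _ _ _ _ _ _ _ levy densX (levy_exponent nu j.1.2))//.
by have [h _] := cfX j.1.2; rewrite /cf h.
Qed.

(** The expectation at time [v] is an explicit sum of exponentials [u v]. Its derivative [u' v] is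
    the expectation of the generator at [X v], hence at most [B], and the mean value theorem
    concludes. *)
Lemma dynkin_le (s : seq (R * Rd R d * R)) (B t : R) : 0 < t ->
  (forall z, generator nu s z <= B) ->
  (\int[P]_w (trig_eval s (X t w))%:E <= (trig_eval s (zeroRd R d) + t * B)%:E)%E.
Proof.
move=> t0 genB.
pose u (v : R) := \sum_(j <- s) j.1.1 * (cos j.2 * expR (- (v * levy_exponent nu j.1.2))).
pose u' (v : R) := \sum_(j <- s) - (j.1.1 * levy_exponent nu j.1.2) *
  (cos j.2 * expR (- (v * levy_exponent nu j.1.2))).
have u'B v : 0 < v -> u' v <= B.
  move=> v0; rewrite -lee_fin -integral_trig_levy//.
  apply: (@le_trans _ _ (\int[P]_w (cst B%:E w))%E); last first.
    by rewrite integral_cst//= probability_setT mule1.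
  have mXv : measurable_fun setT (X v).
    by case: levyX => -[_ + _ _ _] _; apply; exact: ltW.
  apply: le_integral => //.
  - have -> : (fun w => (\sum_(j <- s) - (j.1.1 * levy_exponent nu j.1.2) *
        cos (dotRd j.1.2 (X v w) + j.2))%:E) =
      (fun w => \sum_(j <- s) ((- (j.1.1 * levy_exponent nu j.1.2) *
        cos (dotRd j.1.2 (X v w) + j.2))%:E))%E.
      by apply/funext => w; rewrite sumEFin.
    apply: integrable_sum => // j _.
    apply: (@bounded_integrable _ _ _ _ _ `|- (j.1.1 * levy_exponent nu j.1.2)|) => [|w].
      apply: measurable_funM => //.
      exact: measurableT_comp (measurable_cos_dotRd j.1.2 j.2) mXv.
    by rewrite normrM ler_piMr// cos_max.
  - exact: finite_measure_integrable_cst.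
  - by move=> w _; rewrite lee_fin; exact: genB.
rewrite [leLHS](integral_trig_levy s (fun j => j.1.1) t0) lee_fin -/(u t).
have du (v : R) : is_derive v (1 : R) u (u' v).
  rewrite /u /u'; elim: s {genB u u' u'B} => [|j s' IH].
    rewrite (_ : (fun _ => _) = cst 0); last by apply/funext => w; rewrite big_nil.
    by rewrite big_nil; exact: is_derive_cst.
  rewrite (_ : (fun _ => _) =
      (fun w => j.1.1 * (cos j.2 * expR (- (w * levy_exponent nu j.1.2)))) \+
      (fun w => \sum_(j <- s')
         j.1.1 * (cos j.2 * expR (- (w * levy_exponent nu j.1.2))))); last first.
    by apply/funext => w; rewrite big_cons.
  rewrite big_cons; apply: is_deriveD.
  set a := levy_exponent nu j.1.2.
  have h : is_derive v (1 : R) (fun w : R => - (w * a)) (- a).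
    by apply: is_derive_eq; rewrite /GRing.scale/= mulr1 mulr0 add0r.
  have := @is_derive1_comp R expR _ v _ _ (is_derive_expR _) h.
  move=> /(@is_deriveZ _ _ _ _ (cos j.2)) /(@is_deriveZ _ _ _ _ j.1.1) /is_derive_eq; apply.
  by rewrite /GRing.scale/=; ring.
have uc : continuous u.
  by move=> v; apply: differentiable_continuous; apply/derivable1_diffP; exact: ex_derive.
(* The intermediate time [c] is strictly positive, as [u'B] requires. *)
have [|c] := @MVT R u u' 0 t t0 (fun v _ => du v).
  exact: continuous_subspaceT.
rewrite in_itv/= => /andP[c0 _]; rewrite subr0 => uE.
have -> : u t = u 0 + u' c * t by rewrite -uE addrC subrK.
rewrite lerD// ?[t * B]mulrC ?ler_pM2r ?u'B//.
rewrite le_eqVlt; apply/orP; left; apply/eqP; apply: eq_bigr => j _.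
by rewrite mul0r oppr0 expR0 mulr1 dotRd0r add0r.
Qed.

End dynkin.

(** * Upper bound *)

Section radial.
Context (R : realType) (d : nat).
Implicit Types (x y z : Rd R d) (f : Rd R d -> R).

Lemma normRd0 : normRd (zeroRd R d) = 0.
Proof.
by rewrite /normRd big1 ?sqrtr0// => i _; rewrite tnth_mktuple expr0n.
Qed.

Lemma normRd_gt0 x : x != zeroRd R d -> 0 < normRd x.
Proof.
move=> x0; rewrite lt_neqAle normRd_ge0 andbT eq_sym; apply: contra x0 => /eqP nx.
apply/eqP; apply: eq_from_tnth => i; rewrite tnth_mktuple; apply/eqP.
by rewrite -normr_le0 -nx tnth_normRd.
Qed.

Lemma normRd_neq0 x : 0 < normRd x -> x != zeroRd R d.
Proof. by apply: contraTneq => ->; rewrite normRd0 ltxx. Qed.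

Lemma radial_le f x y : radial_nonincreasing f -> x != zeroRd R d ->
  normRd x <= normRd y -> f y <= f x.
Proof.
move=> [g [g_anti fE]] x0 xy; have nx := normRd_gt0 x0.
by rewrite !fE// ?g_anti// normRd_neq0// (lt_le_trans nx).
Qed.

(** On the box the norm lies between [normRd x / 2] and [normRd x], so [h] is at least [c] and [f]
    at least [f x]; the box has volume [(rho / 2) ^+ d]. It is applied with [f = nu] and with
    [f = p t]. *)
Lemma radial_boxRd f x rho (c : R) (h : Rd R d -> R) : 0 < rho -> 0 <= c ->
  radial_nonincreasing f -> measurable_fun [set: Rd R d] f ->
  measurable_fun [set: Rd R d] h -> (forall y, 0 <= f y) ->
  x != zeroRd R d -> rho * Num.sqrt d%:R = normRd x ->
  (forall y, normRd x / 2 <= normRd y -> c <= h y) ->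
  ((c * f x * (rho / 2) ^+ d)%:E <=
   \int[@lebRd R d]_(y in boxRd `[(rho / 2)%R, rho]) (h y * f y)%:E)%E.
Proof.
move=> rho0 c0 fR mf mh f0 x0 rx hc; have nx := normRd_gt0 x0.
have mB : measurable (@boxRd R d `[rho / 2, rho]).
  by apply: measurable_boxRd; exact: measurable_itv.
have -> : (c * f x * (rho / 2) ^+ d)%:E =
    (\int[@lebRd R d]_(y in boxRd `[(rho / 2)%R, rho]) (cst (c * f x)%:E y))%E.
  rewrite integral_cst//= lebRd_boxRd; last lra.
  by rewrite -EFinM; congr (_ * _ ^+ _)%:E; lra.
apply: ge0_le_integral => //.
- by move=> y _; rewrite lee_fin mulr_ge0.
- by apply/measurable_EFinP; apply: measurable_funTS; exact: measurable_funM.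
- move=> y /(normRd_boxRd rho0); rewrite rx => /andP[y1 y2].
  rewrite lee_fin ler_pM// ?hc//; apply: radial_le => //.
  by apply: normRd_neq0; apply: lt_le_trans y1; rewrite divr_gt0.
Qed.

End radial.

(** * Bound on the generator of the test function *)

Section generator_bound.
Context (R : realType) (d : nat).
Variable nu : Rd R d -> R.
Hypothesis nuP : unimodal_levy_density nu.
Implicit Types (x y z : Rd R d) (rho : R) (N : nat).

Let mnu : measurable_fun [set: Rd R d] nu. Proof. by case: nuP. Qed.
Let nu0 y : 0 <= nu y. Proof. by case: nuP. Qed.

(** The three terms come from jumps inside the ball, from longer jumps within one period window, and
    from longer jumps beyond it. Only the last depends on [N], through [eps]. *)
Lemma generator_bumpRd_le N rho x z (s : seq (R * Rd R d * R)) (i eps : R) :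
  let W := @boxRd R d `[- (pi * N%:R * rho), pi * N%:R * rho] in
  (0 < N)%N -> 0 < rho -> x != zeroRd R d ->
  bumpRd N rho =1 trig_eval s ->
  (\int[@lebRd R d]_(y in [set y | (normRd y <= normRd x)%R])
     (normRd y ^+ 2 * nu y)%:E = i%:E)%E ->
  (\int[@lebRd R d]_(y in ~` [set y | (normRd y <= normRd x)%R])
     (\1_(~` W) y * nu y)%:E <= eps%:E)%E ->
  generator nu s z <= 2 ^+ d * (2 / rho *+ d) ^+ 2 / 2 * i +
    nu x * (4 * pi * rho) ^+ d + 2 ^+ d * eps.
Proof.
move=> W N0 rho0 x0 /funext fs iE epsE.
have [_ _ nuR _] := nuP.
pose c1 : R := 2 ^+ d * (2 / rho *+ d) ^+ 2 / 2.
have c10 : 0 <= c1.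
  by rewrite divr_ge0// mulr_ge0// ?exprn_ge0 ?mulrn_wge0 ?divr_ge0 ?ltW.
pose D := [set y : Rd R d | normRd y <= normRd x].
have mD : measurable D by exact: measurable_ballRd.
have mW : measurable W by apply: measurable_boxRd; exact: measurable_itv.
pose f := @bumpRd R d N rho.
have fT : trigpoly (2 ^+ d) (2 / rho *+ d) f by exact: trigpoly_bumpRd.
have mf : measurable_fun [set: Rd R d] f by exact: measurable_trigpoly fT.
have mfa := measurableT_comp mf (measurable_addRd z).
have mfs := measurableT_comp mf (measurable_subRd z).
have f0 y : 0 <= f y by exact: bumpRd_ge0.
have fA y : f y <= 2 ^+ d.
  by apply: le_trans (ler_norm _) _; exact: trigpoly_le fT.
pose h1 y := \1_D y * (normRd y ^+ 2 * nu y).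
pose ha y := \1_W y * f (addRd z y).
pose hs y := \1_W y * f (subRd z y).
pose h3 y := \1_(~` D) y * (\1_(~` W) y * nu y).
have m1 : measurable_fun [set: Rd R d] h1.
  apply: measurable_funM; first exact: measurable_indic.
  apply: measurable_funM => //; apply: measurable_funX; exact: measurable_normRd.
have ma : measurable_fun [set: Rd R d] ha.
  by apply: measurable_funM => //; exact: measurable_indic.
have ms : measurable_fun [set: Rd R d] hs.
  by apply: measurable_funM => //; exact: measurable_indic.
have m3 : measurable_fun [set: Rd R d] h3.
  apply: measurable_funM; first by apply: measurable_indic; exact: measurableC.
  by apply: measurable_funM => //; apply: measurable_indic; exact: measurableC.
have h10 y : 0 <= h1 y by rewrite mulr_ge0// mulr_ge0// sqr_ge0.
have ha0 y : 0 <= ha y by rewrite mulr_ge0.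
have hs0 y : 0 <= hs y by rewrite mulr_ge0.
have h30 y : 0 <= h3 y by rewrite !mulr_ge0.
have hle y : symdiff f z y * nu y <=
    c1 * h1 y + nu x / 2 * ha y + nu x / 2 * hs y + 2 ^+ d * h3 y.
  have e2 : 0 <= nu x / 2 by rewrite divr_ge0.
  have p2 : 0 <= 2 ^+ d :> R by rewrite exprn_ge0.
  have [yD|yD] := pselect (D y).
    have : symdiff f z y * nu y <= c1 * h1 y.
      rewrite /h1 indicE mem_set// mul1r mulrA ler_wpM2r//.
      by apply: symdiff_le fT; rewrite mulrn_wge0// divr_ge0// ltW.
    have := mulr_ge0 e2 (ha0 y); have := mulr_ge0 e2 (hs0 y).
    by have := mulr_ge0 p2 (h30 y); lra.
  (* For long jumps the term [- f z] is discarded. Then [nu y <= nu x] is used within the window and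
     [f <= 2 ^+ d] beyond it. *)
  have sle : symdiff f z y <= (f (addRd z y) + f (subRd z y)) / 2.
    by rewrite /symdiff lerBlDr lerDl.
  have := ler_wpM2r (nu0 y) sle; set q := symdiff f z y * nu y => qle.
  rewrite /h1 /h3 indicE memNset// mul0r mulr0 add0r.
  rewrite [\1_(~` D) y]indicE mem_set// mul1r.
  have nuyx : nu y <= nu x.
    by apply: radial_le => //; move/negP: yD; rewrite -ltNge => /ltW.
  have fa0 := f0 (addRd z y); have fs0 := f0 (subRd z y).
  have [yW|yW] := pselect (W y).
    rewrite /ha /hs [\1_W y]indicE mem_set// !mul1r.
    rewrite [\1_(~` W) y]indicE memNset// mul0r mulr0 addr0.
    have := ler_wpM2l fa0 nuyx; have := ler_wpM2l fs0 nuyx.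
    by move: qle; rewrite mulrAC mulrDl; lra.
  rewrite /ha /hs [\1_W y]indicE memNset// !mul0r !mulr0 !add0r.
  rewrite [\1_(~` W) y]indicE mem_set// mul1r.
  have := ler_wpM2r (nu0 y) (fA (addRd z y)).
  have := ler_wpM2r (nu0 y) (fA (subRd z y)).
  by move: qle; rewrite mulrAC mulrDl; lra.
have Ha : (\int[@lebRd R d]_y (ha y)%:E <= ((4 * pi * rho) ^+ d)%:E)%E.
  rewrite integral_indicM; apply: (@integral_bumpRd_window R d N rho 1 z) => //.
    exact: normr1.
  by move=> y j; rewrite tnth_mktuple mul1r.
have Hs : (\int[@lebRd R d]_y (hs y)%:E <= ((4 * pi * rho) ^+ d)%:E)%E.
  rewrite integral_indicM; apply: (@integral_bumpRd_window R d N rho (-1) z) => //.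
    by rewrite normrN normr1.
  by move=> y j; rewrite tnth_mktuple mulN1r.
have H3 : (\int[@lebRd R d]_y (h3 y)%:E <= eps%:E)%E by rewrite integral_indicM.
have H1 : (\int[@lebRd R d]_y (h1 y)%:E = i%:E)%E by rewrite integral_indicM.
rewrite -lee_fin -(generatorE nuP) -fs integralE.
pose g y := (symdiff f z y * nu y)%:E.
have mg : measurable_fun [set: Rd R d] g.
  apply/measurable_EFinP; apply: measurable_funM => //.
  apply: measurable_funB => //; apply: measurable_funM => //.
  exact: measurable_funD.
(* The majorant in [hle] is non-negative, so it also dominates the positive part, and the remaining
   integrals are of non-negative functions. *)
apply: (@le_trans _ _ (\int[@lebRd R d]_y g^\+ y)%E).
  by rewrite -[leRHS]sube0 leeB// integral_ge0.
pose k (c : R) (h : Rd R d -> R) y := (c%:E * (h y)%:E)%E.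
have mk (c : R) (h : Rd R d -> R) : measurable_fun [set: Rd R d] h ->
    measurable_fun [set: Rd R d] (k c h).
  by move=> mh; apply/measurable_EFinP; exact: measurable_funM.
have k0 (c : R) (h : Rd R d -> R) : 0 <= c ->
    (forall y, 0 <= h y) -> forall y, (0 <= k c h y)%E.
  by move=> c0 h0 y; rewrite /k -EFinM lee_fin mulr_ge0.
have kE (c : R) (h : Rd R d -> R) : 0 <= c ->
    measurable_fun [set: Rd R d] h -> (forall y, 0 <= h y) ->
    (\int[@lebRd R d]_y k c h y = c%:E * \int[@lebRd R d]_y (h y)%:E)%E.
  move=> c0 mh h0; rewrite ge0_integralZl//; first exact/measurable_EFinP.
  by move=> y _; rewrite lee_fin.
have e2 : 0 <= nu x / 2 by rewrite divr_ge0.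
have p2 : 0 <= 2 ^+ d :> R by rewrite exprn_ge0.
pose c2 : R := nu x / 2; pose c3 : R := 2 ^+ d.
apply: (@le_trans _ _ (\int[@lebRd R d]_y
    (k c1 h1 y + k c2 ha y + k c2 hs y + k c3 h3 y)%E)%E).
  apply: ge0_le_integral => //.
  - exact: measurable_funepos.
  - by do 3?[apply: emeasurable_funD]; exact: mk.
  - move=> y _; rewrite funeposE ge_max !adde_ge0 ?k0// andbT.
    by rewrite /k -!EFinM -!EFinD lee_fin hle.
rewrite ge0_integralD//; last 4 first.
- by move=> y _; rewrite !adde_ge0 ?k0.
- by do 2?[apply: emeasurable_funD]; exact: mk.
- by move=> y _; exact: k0.
- exact: mk.
rewrite ge0_integralD//; last 4 first.
- by move=> y _; rewrite !adde_ge0 ?k0.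
- by apply: emeasurable_funD; exact: mk.
- by move=> y _; exact: k0.
- exact: mk.
rewrite ge0_integralD//; last 4 first.
- by move=> y _; exact: k0.
- exact: mk.
- by move=> y _; exact: k0.
- exact: mk.
rewrite !kE// H1.
have -> : (c1 * i + nu x * (4 * pi * rho) ^+ d + 2 ^+ d * eps)%:E =
    (c1%:E * i%:E + (nu x / 2)%:E * ((4 * pi * rho) ^+ d)%:E +
     (nu x / 2)%:E * ((4 * pi * rho) ^+ d)%:E + (2 ^+ d)%:E * eps%:E)%E.
  by rewrite -!EFinM -!EFinD; congr EFin; field.
by rewrite !leeD// lee_wpmul2l ?lee_fin.
Qed.

End generator_bound.

(** * From the generator bound to the density *)

Section heat_kernel.
Context (R : realType) (d : nat) d0 (T : measurableType d0) (P : probability T R).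
Variables (X : R -> T -> Rd R d) (nu : Rd R d -> R) (p : R -> Rd R d -> R).
Hypothesis nuP : unimodal_levy_density nu.
Hypothesis levyX : pure_jump_levy_process P X nu.
Hypothesis densX : radial_density_of P X p.

(** This controls [nu x] by the truncated second moment: the box lies in the ball, and on it [nu] is
    at least [nu x]. *)
Lemma ball_mass_ge (x : Rd R d) (rho i : R) : 0 < rho -> x != zeroRd R d ->
  rho * Num.sqrt d%:R = normRd x ->
  (\int[@lebRd R d]_(y in [set y | (normRd y <= normRd x)%R])
     (normRd y ^+ 2 * nu y)%:E = i%:E)%E ->
  (normRd x / 2) ^+ 2 * nu x * (rho / 2) ^+ d <= i.
Proof.
move=> rho0 x0 rx iE; have [mnu nu0 nuR _] := nuP.
have mn2 : measurable_fun [set: Rd R d] (fun y => normRd y ^+ 2).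
  by apply: measurable_funX; exact: measurable_normRd.
rewrite -lee_fin -iE.
apply: (@le_trans _ _ (\int[@lebRd R d]_(y in boxRd `[(rho / 2)%R, rho])
    (normRd y ^+ 2 * nu y)%:E)%E).
  apply: (radial_boxRd (h := fun y => normRd y ^+ 2)) => //.
  - by rewrite sqr_ge0.
  - by move=> y xy; rewrite ler_sqr ?nnegrE ?divr_ge0 ?normRd_ge0.
apply: ge0_subset_integral => //.
- by apply: measurable_boxRd; exact: measurable_itv.
- exact: measurable_ballRd.
- by apply/measurable_EFinP; apply: measurable_funTS; exact: measurable_funM.
- by move=> y _; rewrite lee_fin mulr_ge0// sqr_ge0.
- by move=> y /(normRd_boxRd rho0) /andP[_]; rewrite rx.
Qed.

Lemma box_probability_ge (x : Rd R d) (rho t : R) : 0 < t -> 0 < rho ->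
  x != zeroRd R d -> rho * Num.sqrt d%:R = normRd x ->
  ((p t x * (rho / 2) ^+ d)%:E <= P (X t @^-1` boxRd `[(rho / 2)%R, rho]))%E.
Proof.
move=> t0 rho0 x0 rx; have [mp p0 pR pX] := densX t0.
have mB : measurable (@boxRd R d `[rho / 2, rho]).
  by apply: measurable_boxRd; exact: measurable_itv.
(* The box misses the origin, so its probability is given by the density alone. *)
have B0 : boxRd `[rho / 2, rho] `\ zeroRd R d = boxRd `[rho / 2, rho].
  apply/seteqP; split=> [y []//|y By]; split=> // y0.
  move: By => /(normRd_boxRd rho0) /andP[+ _]; rewrite rx y0 normRd0.
  by apply/negP; rewrite -ltNge divr_gt0// normRd_gt0.
have := pX _ mB; rewrite B0 => ->.
have := radial_boxRd rho0 ler01 pR mp (measurable_cst (1 : R)) p0 x0 rx (fun y _ => lexx 1).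
rewrite mul1r => /le_trans; apply; rewrite le_eqVlt; apply/orP; left; apply/eqP.
by apply: eq_integral => y _; rewrite mul1r.
Qed.

(** Markov's inequality for the test function, which is at least [bump_min R ^+ d] on the box. *)
Lemma bumpRd_probability_le (N : nat) (rho t : R) : 0 < t -> (0 < N)%N -> 0 < rho ->
  ((bump_min R ^+ d)%:E * P (X t @^-1` boxRd `[(rho / 2)%R, rho]) <=
   \int[P]_w (bumpRd N rho (X t w))%:E)%E.
Proof.
move=> t0 N0 rho0.
have mXt : measurable_fun setT (X t).
  by case: levyX => -[_ + _ _ _] _; apply; exact: ltW.
have mB : measurable (@boxRd R d `[rho / 2, rho]).
  by apply: measurable_boxRd; exact: measurable_itv.
have mXB : measurable (X t @^-1` boxRd `[rho / 2, rho]).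
  by rewrite -[X in measurable X]setTI; exact: mXt.
have mb := measurable_trigpoly (trigpoly_bumpRd d N0 rho0).
have mbX := measurableT_comp mb mXt.
rewrite -integral_cst//.
apply: (@le_trans _ _ (\int[P]_(w in X t @^-1` boxRd `[(rho / 2)%R, rho])
    (bumpRd N rho (X t w))%:E)%E).
  apply: ge0_le_integral => //.
  - by move=> w _; rewrite lee_fin exprn_ge0// ltW// bump_min_gt0.
  - by apply/measurable_EFinP; exact: measurable_funTS.
  - by move=> w Bw; rewrite lee_fin; exact: bumpRd_boxRd.
apply: ge0_subset_integral => //.
- exact/measurable_EFinP.
- by move=> w _; rewrite lee_fin bumpRd_ge0.
Qed.

Lemma heat_kernel_le (x : Rd R d) (rho i t : R) : (0 < d)%N -> 0 < t -> 0 < rho ->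
  x != zeroRd R d -> rho * Num.sqrt d%:R = normRd x ->
  (\int[@lebRd R d]_(y in [set y | (normRd y <= normRd x)%R])
     (normRd y ^+ 2 * nu y)%:E = i%:E)%E ->
  bump_min R ^+ d * (p t x * (rho / 2) ^+ d) <=
  t * (2 ^+ d * (2 / rho *+ d) ^+ 2 / 2 * i + nu x * (4 * pi * rho) ^+ d).
Proof.
move=> dgt0 t0 rho0 x0 rx iE; have [mnu nu0 _ _] := nuP.
apply/ler_addgt0Pr => e e0.
(* The far-jump term [2 ^+ d * eps] of the generator bound, multiplied by [t], then equals the
   allowed error [e]. *)
pose eps := e / (t * 2 ^+ d).
have t2 : 0 < t * 2 ^+ d by rewrite mulr_gt0// exprn_gt0.
have eps0 : 0 < eps by rewrite divr_gt0.
have nx := normRd_gt0 x0.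
have mD : measurable (~` [set y : Rd R d | normRd y <= normRd x]).
  by apply: measurableC; exact: measurable_ballRd.
have pirho : 0 < pi * rho by rewrite mulr_gt0 ?pi_gt0.
have [n] := integral_outside_boxRd pirho eps0 mD mnu nu0 (integrable_levy_tail nuP nx).
rewrite -[pi * rho * _]mulrAC => epsE.
have [s [fs _ _]] := trigpoly_bumpRd d (ltn0Sn n) rho0.
have gB z := generator_bumpRd_le nuP z (ltn0Sn n) rho0 x0 fs iE epsE.
have := dynkin_le levyX densX t0 gB.
rewrite -fs bumpRd0// add0r.
rewrite (eq_integral (fun w => (bumpRd n.+1 rho (X t w))%:E)); last first.
  by move=> w _; rewrite fs.
move=> E1.
have : ((bump_min R ^+ d * (p t x * (rho / 2) ^+ d))%:E <=
    (t * (2 ^+ d * (2 / rho *+ d) ^+ 2 / 2 * i + nu x * (4 * pi * rho) ^+ d +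
     2 ^+ d * eps))%:E)%E.
  apply: le_trans E1; apply: le_trans (bumpRd_probability_le t0 (ltn0Sn n) rho0).
  rewrite EFinM; apply: lee_wpmul2l; last exact: box_probability_ge.
  by rewrite lee_fin exprn_ge0// ltW// bump_min_gt0.
rewrite lee_fin mulrDr => /le_trans; apply; rewrite lerD2l.
by rewrite mulrA /eps mulrCA divff ?mulr1// lt0r_neq0.
Qed.

End heat_kernel.

Theorem mainTheorem16 (R : realType) (d : nat) :
  exists C : R, 0 < C /\
    forall (d0 : measure_display) (T : measurableType d0) (P : probability T R)
      (X : R -> T -> Rd R d) (nu : Rd R d -> R) (p : R -> Rd R d -> R),
      unimodal_levy_density nu ->
      pure_jump_levy_process P X nu ->
      radial_density_of P X p ->
      forall (t : R) (x : Rd R d), 0 < t -> x != zeroRd R d ->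
        ((p t x)%:E <= (C * t * normRd x ^- d)%:E * Kd nu (normRd x))%E.
Proof.
(* In dimension 0 there is no nonzero point, so any constant works. *)
have [->|d_gt0] := posnP d.
  exists 1; split=> // d0 T P X nu p _ _ _ t x _ /eqP[].
  by rewrite [x]tuple0 [RHS]tuple0.
have dR : 0 < d%:R :> R by rewrite ltr0n.
pose sd : R := Num.sqrt d%:R.
have sd0 : 0 < sd by rewrite sqrtr_gt0.
have sd2 : sd ^+ 2 = d%:R by rewrite sqr_sqrtr// ltW.
have m0 : 0 < bump_min R ^+ d by rewrite exprn_gt0// bump_min_gt0.
(* The first summand is the Taylor constant at [rho = r / sd]. In the second, [8 * pi] comes from
   [4 * pi * rho = 8 * pi * (rho / 2)] and 4 from the square of [r / 2] in [ball_mass_ge]. *)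
pose K : R := 2 ^+ d * (d%:R ^+ 3 * 2) + 4 * (8 * pi) ^+ d.
have K0 : 0 < K.
  by rewrite addr_gt0// ?mulr_gt0 ?exprn_gt0 ?mulr_gt0 ?pi_gt0.
exists ((2 * sd) ^+ d / bump_min R ^+ d * K); split.
  by rewrite mulr_gt0// divr_gt0// exprn_gt0// mulr_gt0.
move=> d0 T P X nu p nuP levyX densX t x t0 x0.
have r0 := normRd_gt0 x0; set r := normRd x in r0 *.
pose rho := r / sd; have rho0 : 0 < rho by rewrite divr_gt0.
have rx : rho * Num.sqrt d%:R = normRd x by rewrite divfK// lt0r_neq0.
have C0 : 0 < (2 * sd) ^+ d / bump_min R ^+ d * K * t * r ^- d.
  have rd0 : 0 < r ^- d by rewrite invr_gt0 exprn_gt0.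
  have sdd0 : 0 < (2 * sd) ^+ d by rewrite exprn_gt0// mulr_gt0.
  by rewrite mulr_gt0// mulr_gt0// mulr_gt0// divr_gt0.
have [_ nu0 _ _] := nuP.
rewrite /Kd -/r.
have : (0 <= \int[@lebRd R d]_(y in [set y | (normRd y <= r)%R])
    (normRd y ^+ 2 * nu y)%:E)%E.
  by apply: integral_ge0 => y _; rewrite lee_fin mulr_ge0// sqr_ge0.
(* [Kd] takes extended real values; if the integral is infinite, so is the right-hand side, its
   other factors being positive. *)
case iE : (\int[_]_(_ in _) _)%E => [i| |]// _; last first.
  by rewrite gt0_muley ?lte_fin ?invr_gt0 ?exprn_gt0// gt0_muley ?lte_fin// leey.
rewrite -!EFinM lee_fin.
have A := ball_mass_ge nuP rho0 x0 rx iE.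
have B := heat_kernel_le nuP levyX densX d_gt0 t0 rho0 x0 rx iE.
(* [v] is the volume of the box; dividing by it produces the factor [r ^- d] of the bound. *)
pose v := (rho / 2) ^+ d; have v0 : 0 < v by rewrite exprn_gt0// divr_gt0.
have vE : v^-1 = (2 * sd) ^+ d * r ^- d.
  by rewrite /v /rho !exprMn !exprVn !invfM !invrK; ring.
have nuxE : nu x * (4 * pi * rho) ^+ d <= 4 * (8 * pi) ^+ d * (r ^- 2 * i).
  have -> : nu x * (4 * pi * rho) ^+ d =
      4 * (8 * pi) ^+ d * (r ^- 2 * ((r / 2) ^+ 2 * nu x * v)).
    rewrite (_ : 4 * pi * rho = (8 * pi) * (rho / 2)); last by field.
    by rewrite exprMn -/v; field; rewrite lt0r_neq0.
  apply: ler_wpM2l; first by rewrite mulr_ge0// exprn_ge0// mulr_ge0// pi_ge0.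
  by apply: ler_wpM2l; rewrite // invr_ge0 exprn_ge0 ?ltW.
have c1E : 2 ^+ d * (2 / rho *+ d) ^+ 2 / 2 * i = 2 ^+ d * (d%:R ^+ 3 * 2) * (r ^- 2 * i).
  rewrite -[_ *+ d]mulr_natr -sd2 /rho; field.
  by rewrite !lt0r_neq0.
rewrite c1E in B.
have B' : bump_min R ^+ d * (p t x * v) <= t * (K * (r ^- 2 * i)).
  by apply: le_trans B _; rewrite ler_pM2l// [leRHS]mulrDl lerD2l.
have -> : (2 * sd) ^+ d / bump_min R ^+ d * K * t * r ^- d * (r ^- 2 * i) =
    (bump_min R ^+ d * v)^-1 * (t * (K * (r ^- 2 * i))).
  by rewrite [(_ * v)^-1]invfM vE; ring.
by rewrite ler_pdivlMl ?mulr_gt0// mulrAC -mulrA.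
Qed.
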